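(* Let $X_1, X_2, \ldots$ be independent and identically distributed real random variables with mean zero and finite variance $\sigma^2 > 0$, and let $S_n = (X_1 + \ldots + X_n)/\sqrt{n}$. Let $Z_{\sigma^2}$ denote a $N(0,\sigma^2)$ random variable. Then $$\lim_{n \to \infty} d_2(S_n, Z_{\sigma^2}) = 0.$$
   Context: For $r>0$, the Mallows $r$-distance between probability distribution functions $F_X$ and $F_Y$ on $\mathbb{R}$ is $d_r(F_X,F_Y) = \left( \inf_{(X,Y)} \mathbb{E}|X-Y|^r \right)^{1/r}$, where the infimum is taken over pairs $(X,Y)$ of random variables (on a common probability space) whose marginal distribution functions are $F_X$ and $F_Y$ respectively; it may be infinite. One writes $d_r(X,Y)$ for $d_r(F_X,F_Y)$, so that $d_r(X,Y)$ depends only on the marginal laws of $X$ and $Y$. *)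

(* Defs.v *)
From HB Require Import structures.
From mathcomp Require Import all_boot all_order all_algebra finmap.
From mathcomp Require Import all_classical all_reals all_analysis measurable_realfun.

Set Implicit Arguments.
Unset Strict Implicit.
Unset Printing Implicit Defensive.

Import Order.TTheory GRing.Theory Num.Theory.
Import numFieldNormedType.Exports.

Local Open Scope classical_set_scope.
Local Open Scope ring_scope.

(* The costs E|X - Y|^r of all couplings (X, Y) of the distribution functions
   F and G; the probability space carrying the coupling is arbitrary. *)
Definition coupling_costs (R : realType) (r : R) (F G : R -> \bar R) :
    set (\bar R) :=
  [set c | exists (d : measure_display) (T : measurableType d)
     (P : probability T R) (X Y : {RV P >-> R}),
     [/\ cdf X = F, cdf Y = G &
         c = ('E_P[(fun w => `|X w - Y w| `^ r)%R])%E]].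

(* Meaningful for 0 < r. *)
Definition mallows (R : realType) (r : R) (F G : R -> \bar R) : \bar R :=
  (ereal_inf (coupling_costs r F G) `^ r^-1)%E.

(* X and Y need not live on the same probability space. *)
Definition mallowsRV (R : realType) (r : R)
    (d : measure_display) (T : measurableType d) (P : probability T R)
    (d' : measure_display) (T' : measurableType d') (P' : probability T' R)
    (X : {RV P >-> R}) (Y : {RV P' >-> R}) : \bar R :=
  mallows r (cdf X) (cdf Y).

Definition mutually_independent (R : realType)
    (d : measure_display) (T : measurableType d) (P : probability T R)
    (I : choiceType) (X : I -> {RV P >-> R}) : Prop :=
  forall (J : {fset I}) (B : I -> set R),
    (forall i, i \in J -> measurable (B i)) ->
    P (\bigcap_(i in [set` J]) (X i @^-1` B i)) =
    (\prod_(i <- J) P (X i @^-1` B i))%E.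

Definition identically_distributed (R : realType)
    (d : measure_display) (T : measurableType d) (P : probability T R)
    (I : Type) (X : I -> {RV P >-> R}) : Prop :=
  forall (i j : I) (A : set R), measurable A ->
    distribution P (X i) A = distribution P (X j) A.

Definition normal_RV (R : realType)
    (d : measure_display) (T : measurableType d) (P : probability T R)
    (m sigma : R) (Z : {RV P >-> R}) : Prop :=
  forall A : set R, measurable A -> distribution P Z A = normal_prob m sigma A.

Section normalized_sum.
Context (R : realType) (d : measure_display) (T : measurableType d)
  (P : probability T R).

(* The sequence is indexed from 0: the n summands are X 0, ..., X (n - 1). *)
Definition normalized_sum (X : nat -> {RV P >-> R}) (n : nat) : T -> R :=
  fun w => (\sum_(i < n) X i w) / Num.sqrt n%:R.

Variables (X : nat -> {RV P >-> R}) (n : nat).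

Lemma measurable_normalized_sum : measurable_fun setT (normalized_sum X n).
Proof.
apply: measurable_funM; last exact: measurable_cst.
by apply: measurable_sum => i; exact: measurable_funP.
Qed.

HB.instance Definition _ := isMeasurableFun.Build _ _ _ _
  (normalized_sum X n) measurable_normalized_sum.

Definition normalized_sumRV : {RV P >-> R} := normalized_sum X n.

End normalized_sum.

(* Main.v *)
(* Let f be a logistic function and S_n, G_n sums of n independent variables,
   distributed as X and as the normal law of the same variance. Exchanging the
   summands one at a time (Lindeberg, in Trotter's form) bounds
   |E f(c S_n) - E f(c G_n)| by n times the sup over b of
   |E f(c X + b) - E f(c G + b)|. The first two moments of X and G agree, so by
   Taylor's formula the latter is of order E min((cX)^2, |cX|^3) plus the same
   for G; with c = a / sqrt n, dominated convergence makes the product tend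
   to 0. As G_n / sqrt n has the law of G, and as steep logistic functions
   approximate indicators of half-lines, the distribution functions of
   S_n / sqrt n converge to the normal one.
   The quantile functions Q_n and Q of S_n / sqrt n and of the normal law, on
   ]0, 1[ with the Lebesgue measure, form a coupling. Strict monotonicity of
   the normal distribution function gives Q_n -> Q pointwise; since Q_n and Q
   have the same second moment sigma^2, Q_n -> Q in L^2, and the L^2 distance
   bounds the Mallows distance. *)

Require Import Defs.
From HB Require Import structures.
From mathcomp Require Import all_boot all_order all_algebra finmap.
From mathcomp Require Import all_classical all_reals all_analysis measurable_realfun.
From mathcomp Require Import ring lra.
Set Implicit Arguments.
Unset Strict Implicit.
Unset Printing Implicit Defensive.
Import Order.TTheory GRing.Theory Num.Theory.
Import numFieldNormedType.Exports.
Local Open Scope classical_set_scope.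
Local Open Scope ring_scope.

(** * Moments and convolution of normal laws *)

(** The Radon-Nikodym derivative of [normal_prob m s] with respect to Lebesgue measure has the same
    integral as [normal_pdf m s] on every measurable set, so the two agree almost everywhere. *)
Lemma ge0_integral_normal_prob (R : realType) (m s : R) (f : R -> \bar R) :
  measurable_fun setT f -> (forall x, 0 <= f x)%E ->
  (\int[normal_prob m s]_x f x =
   \int[lebesgue_measure]_x (f x * (normal_pdf m s x)%:E))%E.
Proof.
move=> mf f0.
have nd := normal_prob_dominates m s.
rewrite -(Radon_Nikodym_SigmaFinite.change_of_variables nd)//.
apply: ae_eq_integral => //.
- apply: emeasurable_funM => //; apply: (measurable_int lebesgue_measure).
  exact: Radon_Nikodym_SigmaFinite.f_integrable nd.
- apply: emeasurable_funM => //.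
  by apply/measurable_EFinP; exact: measurable_normal_pdf.
apply: ae_eqe_mul2l; apply: integral_ae_eq => //.
- exact: Radon_Nikodym_SigmaFinite.f_integrable nd.
- by apply/measurable_EFinP; exact: measurable_normal_pdf.
- by move=> E _ mE; rewrite -Radon_Nikodym_SigmaFinite.f_integral.
Qed.

(** The fundamental theorem of calculus on [-n, n], followed by dominated convergence with [|f|] as
    the bound. *)
Lemma integralT_derive (R : realType) (f F : R -> R) (l : R) :
  continuous f -> lebesgue_measure.-integrable setT (EFin \o f) ->
  (forall x : R, is_derive x (1 : R) F (f x)) ->
  F n%:R - F (- n%:R) @[n --> \oo] --> l ->
  (\int[lebesgue_measure]_x (f x)%:E = l%:E)%E.
Proof.
move=> cf intf dF Fl.
pose fn n x := (f x * \1_(`[- n%:R, n%:R]%classic : set R) x)%:E.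
have mf : measurable_fun setT f by exact: continuous_measurable_fun.
have [] := @dominated_convergence _ _ R lebesgue_measure setT measurableT fn
  (EFin \o f) (fun x => `|f x|%:E).
- by move=> n; apply/measurable_EFinP/measurable_funM.
- exact/measurable_EFinP.
- apply: aeW => x _; apply: cvg_near_cst; near=> n.
  rewrite /fn indicE mem_set ?mulr1// /= in_itv/= -ler_norml.
  by near: n; exact: nbhs_infty_ger.
- exact: (integrable_norm intf).
- apply: aeW => x n _; rewrite /fn /= lee_fin normrM ler_piMr// indicE.
  by case: (_ \in _); rewrite ?normr1 ?normr0.
move=> _ _ fnl; apply: (cvg_unique _ fnl) => //.
suff -> : [sequence (\int[lebesgue_measure]_x fn n x)%E]_n =
   (fun n => (F n%:R - F (- n%:R))%:E).
  by apply/fine_cvgP; split; [exact: nearW|exact: Fl].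
apply/funext => n /=.
have FC x : {for x, continuous F}.
  by apply/differentiable_continuous/derivable1_diffP; have [] := dF x.
transitivity (\int[lebesgue_measure]_(x in `[(- n%:R)%R, n%:R%R]) (f x)%:E)%E.
  rewrite [RHS]integral_mkcond; apply: eq_integral => x _.
  rewrite /fn patchE indicE; case: ifPn; rewrite ?mulr1 ?mulr0//.
have [->|n0] := posnP n.
  by rewrite oppr0 subrr set_itv1 integral_set1.
rewrite (@continuous_FTC2 _ f F)//.
- by rewrite gtrN// ltr0n.
- exact: continuous_subspaceT.
- split; [by move=> x _; have [] := dF x| |].
  + exact/cvg_at_right_filter/FC.
  + exact/cvg_at_left_filter/FC.
- by move=> x _; rewrite derive1E; have [_ ->] := dF x.
Unshelve. all: by end_near. Qed.

Lemma is_derive_normal_pdf (R : realType) (s x : R) : s != 0 ->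
  is_derive x (1 : R) (normal_pdf 0 s) (- (x / s ^+ 2) * normal_pdf 0 s x).
Proof.
move=> s0; rewrite normal_pdfE//.
have h (y : R) : normal_fun 0 s y = expR (- (2 * s ^+ 2)^-1 * (y * y)).
  by rewrite /normal_fun; congr expR; field.
rewrite (_ : (fun y => _) = normal_peak s \*: (expR \o ((- (2 * s ^+ 2)^-1) \*: (id * id)))); last first.
  by apply/funext => y; rewrite h.
apply: is_derive_eq.
by rewrite /= /GRing.scale/= !mulr1 h; set e := expR _; field.
Qed.

(** Write the Gaussian factor as e * e with e = exp(- x^2 / (4 s^2)). One factor absorbs x^2, since
    t <= exp t; the other is the Gaussian factor of variance 2 s^2. This gives an integrable
    bound. *)
Lemma sqr_normal_pdf_le (R : realType) (s x : R) : s != 0 ->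
  x ^+ 2 * normal_pdf 0 s x <= 4 * s ^+ 2 * normal_peak s /
    normal_peak (Num.sqrt 2 * s) * normal_pdf 0 (Num.sqrt 2 * s) x.
Proof.
move=> s0; have q0 : Num.sqrt 2 * s != 0.
  by rewrite mulf_neq0// sqrtr_eq0 -ltNge ltr0n.
have s2 : 0 < s ^+ 2 by rewrite exprn_even_gt0.
rewrite !normal_pdfE//=.
have p0 := normal_peak_gt0 s0; have p'0 := normal_peak_gt0 q0.
set e := expR (- (x ^+ 2 / (4 * s ^+ 2))).
have e0 : 0 < e by exact: expR_gt0.
have -> : normal_fun 0 (Num.sqrt 2 * s) x = e.
  by rewrite /normal_fun /e exprMn sqr_sqrtr//; congr expR; field.
have -> : normal_fun 0 s x = e * e.
  by rewrite /normal_fun /e -expRD; congr expR; field.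
have xe : x ^+ 2 * e <= 4 * s ^+ 2.
  rewrite /e expRN ler_pdivrMr ?expR_gt0// -ler_pdivrMl; last by apply: mulr_gt0.
  rewrite mulrC; apply: le_trans (expR_ge1Dx _); lra.
rewrite (_ : _ / _ * _ = normal_peak s * (4 * s ^+ 2) * e); last first.
  by field; rewrite gt_eqF.
rewrite (_ : _ * (_ * _) = normal_peak s * (x ^+ 2 * e) * e); last by ring.
by rewrite ler_pM2r// ler_pM2l.
Qed.

Section normal_moments.
Context {R : realType} (s : R).
Hypothesis s0 : s != 0.
Notation mu := (@lebesgue_measure R).

Lemma integrable_sqr_normal_pdf :
  mu.-integrable setT (fun x : R => (x ^+ 2 * normal_pdf 0 s x)%:E).
Proof.
pose C := 4 * s ^+ 2 * normal_peak s / normal_peak (Num.sqrt 2 * s).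
apply: (@le_integrable _ _ _ mu _ _ _
  (fun x => C%:E * (normal_pdf 0 (Num.sqrt 2 * s) x)%:E)%E) => //.
- apply/measurable_EFinP/measurable_funM; first exact: measurable_funX.
  exact: measurable_normal_pdf.
- move=> x _; rewrite -EFinM /= lee_fin ger0_norm; last first.
    by rewrite mulr_ge0 ?sqr_ge0// normal_pdf_ge0.
  by rewrite (le_trans (sqr_normal_pdf_le x s0))// ler_norm.
- by apply: integrableZl => //; exact: integrable_normal_pdf.
Qed.

Lemma integrable_id_normal_pdf :
  mu.-integrable setT (fun x : R => (x * normal_pdf 0 s x)%:E).
Proof.
apply: (@le_integrable _ _ _ mu _ _ _
  ((fun x => (normal_pdf 0 s x)%:E) \+ (fun x => (x ^+ 2 * normal_pdf 0 s x)%:E))%E) => //.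
- apply/measurable_EFinP/measurable_funM => //; exact: measurable_normal_pdf.
- move=> x _; rewrite /= lee_fin normrM.
  have p0 := @normal_pdf_ge0 R 0 s x.
  rewrite (ger0_norm p0) -{2}[normal_pdf _ _ _]mul1r -mulrDl normrM (ger0_norm p0).
  rewrite ler_wpM2r// [leRHS]ger0_norm ?addr_ge0 ?sqr_ge0//.
  rewrite -real_normK ?num_real//; have := sqr_ge0 (`|x| - 1); nra.
- apply: integrableD => //; first exact: integrable_normal_pdf.
  exact: integrable_sqr_normal_pdf.
Qed.

Lemma integral_id_normal_pdf : (\int[mu]_x (x * normal_pdf 0 s x)%:E = 0)%E.
Proof.
have c : continuous (normal_pdf 0 s) := @continuous_normal_pdf R 0 s s0.
apply: (@integralT_derive _ _ (fun x => - s ^+ 2 * normal_pdf 0 s x)).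
- by move=> x; apply: cvgM; [exact: cvg_id|exact: c].
- exact: integrable_id_normal_pdf.
- move=> x; have := is_derive_normal_pdf x s0 => dp.
  rewrite (_ : (fun y => _) = (- s ^+ 2) \*: normal_pdf 0 s)//.
  by apply: is_derive_eq; rewrite /GRing.scale/=; field.
- apply: cvg_near_cst; apply: nearW => n; rewrite !normal_pdfE// /normal_fun.
  by rewrite !subr0 sqrrN subrr.
Qed.

Lemma integral_sqr_normal_pdf :
  (\int[mu]_x (x ^+ 2 * normal_pdf 0 s x)%:E = (s ^+ 2)%:E)%E.
Proof.
have c : continuous (normal_pdf 0 s) := @continuous_normal_pdf R 0 s s0.
(* Subtracting s^2 times the density leaves an exact derivative, that of - s^2 x p(x) with p the
   density; its integral is 0 because x p(x) vanishes at infinity. *)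
pose f x := x ^+ 2 * normal_pdf 0 s x - s ^+ 2 * normal_pdf 0 s x.
have i1 : mu.-integrable setT (fun x : R => (s ^+ 2 * normal_pdf 0 s x)%:E).
  by under eq_fun do rewrite EFinM; apply: integrableZl => //; exact: integrable_normal_pdf.
have intf : mu.-integrable setT (EFin \o f).
  apply: (@integrableB _ _ _ mu setT measurableT _ _ integrable_sqr_normal_pdf i1).
suff: (\int[mu]_x (f x)%:E = 0)%E.
  under eq_integral do rewrite /f EFinB.
  rewrite integralB//; last exact: integrable_sqr_normal_pdf.
  under [X in (_ - X)%E]eq_integral do rewrite EFinM.
  rewrite integralZl//; last exact: integrable_normal_pdf.
  rewrite integral_normal_pdf.
  have := integrable_fin_num measurableT integrable_sqr_normal_pdf.
  case: (integral _ _ _) => // r _ /eqP.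
  by rewrite -EFinM mulr1 -EFinB eqe subr_eq0 => /eqP ->.
apply: (@integralT_derive _ _ (fun x => - s ^+ 2 * (x * normal_pdf 0 s x))).
- move=> x; apply: cvgB; apply: cvgM; [exact: sqr_continuous|exact: c|exact: cvg_cst|exact: c].
- exact: intf.
- move=> x; have := is_derive_normal_pdf x s0 => dp.
  rewrite (_ : (fun y => _) = (- s ^+ 2) \*: (id * normal_pdf 0 s))//.
  by apply: is_derive_eq; rewrite /GRing.scale/= /f; field.
(* [K] bounds 2 s^2 n^2 p(n), by [sqr_normal_pdf_le] and the peak of the wider density; the boundary
   term 2 s^2 n p(n) is then at most K / n. *)
- pose K := 4 * s ^+ 2 * normal_peak s / normal_peak (Num.sqrt 2 * s) *
    normal_peak (Num.sqrt 2 * s) * s ^+ 2 *+ 2.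
  apply/cvgr0Pnorm_le => e e0; near=> n.
  have n0 : 0 < n%:R :> R by rewrite ltr0n; near: n; exists 1%N.
  have -> : normal_pdf 0 s (- n%:R) = normal_pdf 0 s n%:R.
    by rewrite !normal_pdfE// /normal_fun !subr0 sqrrN.
  rewrite (_ : _ - _ = - ((n%:R ^+ 2 * normal_pdf 0 s n%:R) * s ^+ 2 *+ 2) / n%:R); last first.
    by field; rewrite gt_eqF.
  rewrite normrM normrN normfV ger0_norm; last first.
    by rewrite mulrn_wge0// mulr_ge0 ?sqr_ge0// mulr_ge0 ?sqr_ge0 ?normal_pdf_ge0.
  rewrite (gtr0_norm n0) ler_pdivrMr//.
  apply: (@le_trans _ _ K).
    rewrite /K lerMn2r/= ler_wpM2r ?sqr_ge0//.
    have q0 : Num.sqrt 2 * s != 0 by rewrite mulf_neq0// sqrtr_eq0 -ltNge ltr0n.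
    apply: (le_trans (sqr_normal_pdf_le _ s0)).
    rewrite ler_wpM2l ?normal_pdf_ub// mulr_ge0 ?invr_ge0 ?normal_peak_ge0//.
    by rewrite mulr_ge0 ?normal_peak_ge0// mulr_ge0 ?sqr_ge0.
  rewrite mulrC -ler_pdivrMr//; near: n; exact: nbhs_infty_ger.
Unshelve. all: by end_near. Qed.

End normal_moments.

Lemma integral_normal_prob (R : realType) (m s : R) (f : R -> \bar R) :
  measurable_fun setT f ->
  (\int[normal_prob m s]_x f x =
   \int[lebesgue_measure]_x (f x * (normal_pdf m s x)%:E))%E.
Proof.
move=> mf.
have pdf0 x : (0 <= (normal_pdf m s x)%:E)%E by rewrite lee_fin normal_pdf_ge0.
rewrite integralE [RHS]integralE.
congr (_ - _)%E; rewrite ge0_integral_normal_prob//;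
  try (exact: measurable_funepos) || (exact: measurable_funeneg);
  apply: eq_integral => x _; rewrite ?funeposE ?funenegE muleC maxe_pMr// mule0.
  by rewrite muleC.
by rewrite muleN muleC.
Qed.

Lemma integrable_normal_prob (R : realType) (m s : R) (f : R -> \bar R) :
  measurable_fun setT f ->
  lebesgue_measure.-integrable setT (fun x => f x * (normal_pdf m s x)%:E)%E ->
  (normal_prob m s).-integrable setT f.
Proof.
move=> mf /integrableP[_ fi]; apply/integrableP; split => //.
rewrite integral_normal_prob//; last exact: measurableT_comp.
apply: le_lt_trans fi; rewrite le_eqVlt; apply/orP; left; apply/eqP.
apply: eq_integral => x _; rewrite abseM; congr (_ * _)%E.
by rewrite gee0_abs// lee_fin normal_pdf_ge0.
Qed.

Section normal_prob_moments.
Context {R : realType} (s : R).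
Hypothesis s0 : s != 0.

Lemma normal_prob_mean : (\int[normal_prob 0 s]_x x%:E = 0)%E.
Proof.
rewrite integral_normal_prob; last exact/measurable_EFinP.
exact: integral_id_normal_pdf.
Qed.

Lemma normal_prob_sqr : (\int[normal_prob 0 s]_x (x ^+ 2)%:E = (s ^+ 2)%:E)%E.
Proof.
rewrite integral_normal_prob; last exact/measurable_EFinP/measurable_funX.
exact: integral_sqr_normal_pdf.
Qed.

End normal_prob_moments.

(** Completing the square in x: the joint density of a summand and the sum is the density of the sum
    at u times the conditional density of the summand given u. *)
Lemma normal_pdf_conv (R : realType) (s t x u : R) : s != 0 -> t != 0 ->
  let r := Num.sqrt (s ^+ 2 + t ^+ 2) in
  normal_pdf 0 t (u - x) * normal_pdf 0 s x =
  normal_pdf 0 r u * normal_pdf (s ^+ 2 * u / r ^+ 2) (s * t / r) x.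
Proof.
move=> s0 t0 r.
have s2 : 0 < s ^+ 2 by rewrite exprn_even_gt0.
have t2 : 0 < t ^+ 2 by rewrite exprn_even_gt0.
have st2 : 0 < s ^+ 2 + t ^+ 2 by rewrite addr_gt0.
have r2 : r ^+ 2 = s ^+ 2 + t ^+ 2 by rewrite sqr_sqrtr// ltW.
have r0 : r != 0 by rewrite sqrtr_eq0 -ltNge.
have w0 : s * t / r != 0 by rewrite mulf_neq0 ?invr_eq0// mulf_neq0.
rewrite !normal_pdfE//= mulrACA [RHS]mulrACA.
have nn (v : R) : 0 <= v ^+ 2 * pi *+ 2.
  by rewrite mulrn_wge0// mulr_ge0 ?sqr_ge0 ?pi_ge0.
congr (_ * _).
  rewrite /normal_peak -!invfM -!sqrtrM //.
  congr (Num.sqrt _)^-1.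
  by rewrite !exprMn exprVn; field.
rewrite /normal_fun -!expRD; congr expR.
rewrite !exprMn exprVn r2; field.
by rewrite ?s0 ?t0 ?gt_eqF.
Qed.

(** Substituting u = x + y in the inner integral and exchanging by Tonelli, the x-integral of the
    conditional density in [normal_pdf_conv] is 1. Continuity of [f] serves the substitution. *)
Lemma normal_prob_conv (R : realType) (s t : R) (f : R -> R) :
  s != 0 -> t != 0 -> continuous f -> (forall x, 0 <= f x) ->
  (\int[normal_prob 0 (Num.sqrt (s ^+ 2 + t ^+ 2))]_x (f x)%:E =
   \int[normal_prob 0 s]_x \int[normal_prob 0 t]_y (f (x + y))%:E)%E.
Proof.
move=> s0 t0 cf f0.
set r := Num.sqrt _.
have mf : measurable_fun setT f by exact: continuous_measurable_fun.
pose h (z : R * R) : \bar R :=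
  (f z.2 * (normal_pdf 0 t (z.2 - z.1) * normal_pdf 0 s z.1))%:E.
have mp v : measurable_fun setT (normal_pdf 0 v : R -> R).
  exact: measurable_normal_pdf.
have mh : measurable_fun setT h.
  apply/measurable_EFinP; apply: measurable_funM.
    by apply: measurableT_comp => //; exact: measurable_snd.
  apply: measurable_funM.
    apply: measurableT_comp => //; apply: measurable_funB.
      exact: measurable_snd.
    exact: measurable_fst.
  by apply: measurableT_comp => //; exact: measurable_fst.
have h0 z : (0 <= h z)%E.
  by rewrite lee_fin mulr_ge0// mulr_ge0 ?normal_pdf_ge0.
have inner x : (\int[normal_prob 0 t]_y (f (x + y))%:E =
    \int[lebesgue_measure]_u (f u * normal_pdf 0 t (u - x))%:E)%E.
  rewrite integral_normal_prob; last first.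
    by apply/measurable_EFinP/measurableT_comp => //; exact: measurable_funD.
  under eq_integral do rewrite -EFinM.
  have dE : ((fun u : R => u - x)^`())%classic = cst 1.
    by apply/funext => u; rewrite derive1E; rewrite deriveB//= derive_id derive_cst subr0.
  rewrite (@increasing_ge0_integration_by_substitutionT _ (fun u => u - x)
    (fun y => f (x + y) * normal_pdf 0 t y))//; rewrite ?dE.
  - apply: eq_integral => u _.
    by rewrite fctE/= mulr1 subrKC.
  - by move=> a b ab; rewrite ltrD2r.
  - by move=> a; exact: cvg_cst.
  - exact: is_cvg_cst.
  - exact: is_cvg_cst.
  - exact: cvg_addrr_Ny.
  - exact: cvg_addrr.
  - move=> y; apply: cvgM; last exact: continuous_normal_pdf.
    apply: continuous_comp; last exact: cf.
    by apply: cvgD; [exact: cvg_cst|exact: cvg_id].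
  - by move=> y; rewrite mulr_ge0 ?normal_pdf_ge0.
under [RHS]eq_integral do rewrite inner.
have innerE x : ((\int[lebesgue_measure]_u (f u * normal_pdf 0 t (u - x))%:E) *
   (normal_pdf 0 s x)%:E = \int[lebesgue_measure]_u h (x, u))%E.
  rewrite -ge0_integralZr//.
  - by apply: eq_integral => u _; rewrite -EFinM -mulrA.
  - apply/measurable_EFinP/measurable_funM => //.
    by apply: measurableT_comp => //; exact: measurable_funB.
  - by move=> y _; rewrite lee_fin mulr_ge0// normal_pdf_ge0.
  - by rewrite lee_fin normal_pdf_ge0.
rewrite integral_normal_prob; last first.
  exact/measurable_EFinP.
rewrite [RHS]integral_normal_prob; last first.
  pose k (z : R * R) : \bar R := (f z.2 * normal_pdf 0 t (z.2 - z.1))%:E.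
  have mk : measurable_fun setT k.
    apply/measurable_EFinP; apply: measurable_funM.
      by apply: measurableT_comp => //; exact: measurable_snd.
    apply: measurableT_comp => //; apply: measurable_funB.
      exact: measurable_snd.
    exact: measurable_fst.
  apply: (@measurable_fun_fubini_tonelli_F _ _ _ _ _ lebesgue_measure k) => //.
  by move=> z; rewrite lee_fin mulr_ge0// normal_pdf_ge0.
under [RHS]eq_integral do rewrite innerE.
rewrite (@fubini_tonelli _ _ _ _ _ lebesgue_measure lebesgue_measure h)//.
apply: eq_integral => u _; rewrite /h/=.
under eq_integral do rewrite normal_pdf_conv// mulrA EFinM.
rewrite ge0_integralZl//.
- by rewrite integral_normal_pdf mule1 EFinM.
- by apply/measurable_EFinP; exact: measurable_normal_pdf.
- by move=> y _; rewrite lee_fin normal_pdf_ge0.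
- by rewrite lee_fin mulr_ge0// normal_pdf_ge0.
Qed.

(** * Second-order Taylor bound for the logistic function *)

(** The mean value theorem between 0 and x. The factor 1 / (k + 1) that integration would give is
    dropped, so iterating keeps the same constant. *)
Lemma normr_le_derive_exp (R : realType) (h dh : R -> R) (C : R) (k : nat) :
  (forall x : R, is_derive x (1 : R) h (dh x)) -> h 0 = 0 -> 0 <= C ->
  (forall x, `|dh x| <= C * `|x| ^+ k) -> forall x, `|h x| <= C * `|x| ^+ k.+1.
Proof.
move=> hd h0 C0 dhC x.
have hc (a b : R) : {within `[a, b], continuous h}.
  apply: continuous_subspaceT => y.
  by apply/differentiable_continuous/derivable1_diffP; have [] := hd y.
have key c : `|c| <= `|x| -> h x = dh c * x -> `|h x| <= C * `|x| ^+ k.+1.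
  move=> cx ->; rewrite normrM exprSr mulrA ler_wpM2r//.
  by rewrite (le_trans (dhC c))// ler_wpM2l// lerXn2r.
have [x0|x0|<-] := ltgtP 0 x; last by rewrite h0 normr0 expr0n mulr0.
  have [c] := MVT x0 (fun y _ => hd y) (hc _ _).
  rewrite in_itv/= => /andP[c0 cx]; rewrite h0 !subr0; apply: key.
  by rewrite !gtr0_norm// ltW.
have [c] := MVT x0 (fun y _ => hd y) (hc _ _).
rewrite in_itv/= => /andP[c0 cx]; rewrite h0 !sub0r mulrN => /oppr_inj.
by apply: key; rewrite !ltr0_norm// lerN2 ltW.
Qed.

Section logistic.
Context {R : realType}.
Implicit Types x y : R.

(** The decreasing variant, from 1 at -oo to 0 at +oo: its steep rescalings approximate indicators
    of left half-lines, whose integrals are distribution functions. *)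
Definition logistic x : R := (1 + expR x)^-1.

Lemma logistic_gt0 x : 0 < logistic x.
Proof. by rewrite invr_gt0 addr_gt0 ?expR_gt0. Qed.

Lemma logistic_lt1 x : logistic x < 1.
Proof. by rewrite invf_lt1 ?addr_gt0 ?expR_gt0// ltrDl expR_gt0. Qed.

(** Since g' = - g (1 - g), all derivatives of g are polynomials in g, hence bounded because 0 < g <
    1. *)
Definition dlogistic x := - (logistic x * (1 - logistic x)).
Definition d2logistic x := logistic x * (1 - logistic x) * (1 - 2 * logistic x).
Let d3 x := dlogistic x * ((1 - logistic x) * (1 - 2 * logistic x)
  - logistic x * (1 - 2 * logistic x) - 2 * (logistic x * (1 - logistic x))).

Lemma is_derive_logistic x : is_derive x (1 : R) logistic (dlogistic x).
Proof.
have e0 := expR_gt0 x.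
have h : (cst 1 + expR : R -> R) x != 0 by rewrite fctE gt_eqF// addr_gt0.
have he : is_derive x (1 : R) (cst 1 + expR) (expR x).
  by apply: is_derive_eq; rewrite add0r.
rewrite (_ : logistic = fun y => ((cst 1 + expR : R -> R) y)^-1)//.
apply: (is_derive_eq (is_deriveV h he)).
by rewrite /dlogistic /logistic /GRing.scale/= fctE/=; field; rewrite gt_eqF// addr_gt0.
Qed.

Lemma continuous_logistic : continuous logistic.
Proof.
move=> x; apply/differentiable_continuous/derivable1_diffP.
by have [] := is_derive_logistic x.
Qed.

Let is_derive_d1 x : is_derive x (1 : R) dlogistic (d2logistic x).
Proof.
have h := is_derive_logistic x.
rewrite (_ : dlogistic = - (logistic * (cst 1 - logistic)))//.
by apply: is_derive_eq; rewrite /d2logistic /dlogistic !fctE /= /GRing.scale/=; ring.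
Qed.

Let is_derive_d2 x : is_derive x (1 : R) d2logistic (d3 x).
Proof.
have h := is_derive_logistic x.
rewrite (_ : d2logistic = logistic * (cst 1 - logistic) * (cst 1 - 2 \*: logistic))//.
by apply: is_derive_eq; rewrite /d3 /dlogistic !fctE /= /GRing.scale/=; ring.
Qed.

Let d2_le x : `|d2logistic x| <= 1.
Proof.
have g0 := logistic_gt0 x; have g1 := logistic_lt1 x.
by rewrite /d2logistic ler_norml; nra.
Qed.

Let d3_le x : `|d3 x| <= 4.
Proof.
have g0 := logistic_gt0 x; have g1 := logistic_lt1 x.
rewrite /d3 /dlogistic normrM -[4]mul1r ler_pM//.
  by rewrite normrN ler_norml; nra.
by rewrite ler_norml; nra.
Qed.

Definition logistic_taylor x y :=
  logistic x + dlogistic x * y + d2logistic x / 2 * y ^+ 2.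

Let is_derive_translate (f df : R -> R) x y :
  (forall z : R, is_derive z (1 : R) f (df z)) ->
  is_derive y (1 : R) (f \o (cst x + id)) (df (x + y)).
Proof.
by move=> h; apply: is_derive_eq; rewrite add0r mulr1.
Qed.

(** The remainder [r0] and its derivatives [r1] and [r2] vanish at 0. Starting from [|r2| <= 2], two
    uses of [normr_le_derive_exp] give the quadratic bound; starting from [|d3| <= 4], three uses
    give the cubic one. *)
Lemma logistic_taylor_le x y :
  `|logistic (x + y) - logistic_taylor x y| <= 4 * Num.min (y ^+ 2) (`|y| ^+ 3).
Proof.
pose r2 := (d2logistic \o (cst x + id)) - cst (d2logistic x).
pose r1 := (dlogistic \o (cst x + id)) - cst (dlogistic x) - d2logistic x \*: id.
pose r0 := (logistic \o (cst x + id)) - cst (logistic x) - dlogistic x \*: id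
   - (d2logistic x / 2) \*: (id * id).
have h2 z : is_derive z (1 : R) r2 (d3 (x + z)).
  have := is_derive_translate x z is_derive_d2 => h.
  by apply: is_derive_eq; rewrite subr0.
have h1 z : is_derive z (1 : R) r1 (r2 z).
  have := is_derive_translate x z is_derive_d1 => h.
  by apply: is_derive_eq; rewrite /r2 !fctE /= /GRing.scale/=; ring.
have h0 z : is_derive z (1 : R) r0 (r1 z).
  have := is_derive_translate x z is_derive_logistic => h.
  by apply: is_derive_eq; rewrite /r1 !fctE /= /GRing.scale/=; field.
have r20 : r2 0 = 0 by rewrite /r2 !fctE /= addr0 subrr.
have r10 : r1 0 = 0 by rewrite /r1 !fctE /= addr0 subrr /GRing.scale/= mulr0 subr0.
have r00 : r0 0 = 0.
  by rewrite /r0 !fctE /= addr0 subrr /GRing.scale/= !mulr0 !subr0.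
have -> : logistic (x + y) - logistic_taylor x y = r0 y.
  by rewrite /r0 /logistic_taylor !fctE /= /GRing.scale/=; ring.
rewrite minr_pMr// le_min; apply/andP; split.
  rewrite -[y ^+ 2]real_normK ?num_real//.
  apply: (@le_trans _ _ (2 * `|y| ^+ 2)); last by rewrite ler_wpM2r// ler_nat.
  apply: (normr_le_derive_exp h0) => // z.
  apply: (normr_le_derive_exp h1) => // w; rewrite mulr1.
  have := d2_le (x + w); have := d2_le x; rewrite /r2 !fctE/= !ler_norml; lra.
apply: (normr_le_derive_exp h0) => // z.
apply: (normr_le_derive_exp h1) => // w.
apply: (normr_le_derive_exp h2) => // v; rewrite mulr1; exact: d3_le.
Qed.

End logistic.

(** * Lindeberg exchange *)

Lemma Rintegral_prob_cst d (T : measurableType d) (R : realType)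
  (P : probability T R) (r : R) : \int[P]_x r = r.
Proof.
rewrite Rintegral_cst// -[RHS]mulr1; congr (_ * _).
by transitivity (fine 1%E : R) => //; congr fine; exact: probability_setT.
Qed.

Section unit_valued.
Context {R : realType}.
Notation prob := (probability R R).
Implicit Types (m n : prob) (f g : R -> R).

(** This class is integrable for every probability and stable under translation and convolution, so
    the exchange argument never leaves it. *)
Definition unit_valued f := measurable_fun setT f /\ forall x, 0 <= f x <= 1.

Lemma unit_valued_integrable m f : unit_valued f ->
  m.-integrable setT (EFin \o f).
Proof.
move=> [mf f01]; apply: measurable_bounded_integrable => //.
  by rewrite (le_lt_trans (probability_le1 _ _)) ?ltry.
exists 1; split=> // M M1 x _ /=; have /andP[f0 f1] := f01 x.
by rewrite ger0_norm// (le_trans f1)// ltW.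
Qed.

Lemma unit_valued_EFin m f : unit_valued f ->
  (\int[m]_x (f x)%:E)%E = (\int[m]_x f x)%:E.
Proof.
move=> uf; rewrite fineK//; apply: integrable_fin_num => //.
exact: unit_valued_integrable.
Qed.

Lemma unit_valued_integral m f : unit_valued f -> 0 <= \int[m]_x f x <= 1.
Proof.
move=> uf; have [mf f01] := uf; apply/andP; split.
  by apply: Rintegral_ge0 => x _; have /andP[] := f01 x.
rewrite -[leRHS](Rintegral_prob_cst m); apply: le_Rintegral => //.
- exact: unit_valued_integrable.
- exact: (finite_measure_integrable_cst m).
- by move=> x _; have /andP[] := f01 x.
Qed.

Lemma unit_valued_translate f b : unit_valued f ->
  unit_valued (fun x => f (x + b)).
Proof.
move=> [mf f01]; split=> [|x//].
by apply: measurableT_comp => //; exact: measurable_funD.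
Qed.

Lemma unit_valued_convolution m f : unit_valued f ->
  unit_valued (fun y => \int[m]_x f (x + y)).
Proof.
move=> uf; split=> [|y]; last first.
  by apply: unit_valued_integral; exact: unit_valued_translate.
have [mf f01] := uf.
pose k (z : R * R) : \bar R := (f (z.2 + z.1))%:E.
apply: measurableT_comp => //.
apply: (@measurable_fun_fubini_tonelli_F _ _ _ _ _ m k) => //.
- apply/measurable_EFinP/measurableT_comp => //; apply: measurable_funD.
    exact: measurable_snd.
  exact: measurable_fst.
- by move=> z; rewrite lee_fin; have /andP[] := f01 (z.2 + z.1).
Qed.

Lemma unit_valued_Fubini m n f : unit_valued f ->
  \int[m]_x \int[n]_y f (x + y) = \int[n]_y \int[m]_x f (x + y).
Proof.
move=> uf; have [mf f01] := uf.
apply: EFin_inj; rewrite -!unit_valued_EFin; first last.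
- under eq_fun do under eq_Rintegral do rewrite addrC.
  exact: unit_valued_convolution.
- exact: unit_valued_convolution.
under eq_integral=> x _.
  rewrite -unit_valued_EFin; last first.
    by under eq_fun do rewrite addrC; exact: unit_valued_translate.
  over.
under [RHS]eq_integral=> y _.
  rewrite -unit_valued_EFin; last exact: unit_valued_translate.
  over.
apply: (@fubini_tonelli _ _ _ _ _ m n (fun z => (f (z.1 + z.2))%:E)) => //.
- apply/measurable_EFinP/measurableT_comp => //; apply: measurable_funD.
    exact: measurable_fst.
  exact: measurable_snd.
- by move=> z; rewrite lee_fin; have /andP[] := f01 (z.1 + z.2).
Qed.

Lemma unit_valued_dist m f g e : unit_valued f -> unit_valued g ->
  (forall x, `|f x - g x| <= e) ->
  `|\int[m]_x f x - \int[m]_x g x| <= e.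
Proof.
move=> uf ug fge; have intf := unit_valued_integrable m uf.
have intg := unit_valued_integrable m ug.
rewrite -RintegralB//; apply: le_trans (le_normr_Rintegral _ _) _ => //.
  by rewrite /comp; under eq_fun do rewrite EFinB; exact: integrableB.
rewrite -[leRHS](Rintegral_prob_cst m); apply: le_Rintegral => //.
- apply: (@integrable_norm _ _ _ m setT (fun x => f x - g x)).
  by rewrite /comp; under eq_fun do rewrite EFinB; exact: integrableB.
- exact: (finite_measure_integrable_cst m).
Qed.

End unit_valued.

(* [convolves mu m] : mu k is the law of the sum of k + 1 independent variables
   of law m. *)
Definition convolves (R : realType)
    (mu : nat -> probability R R)
    (m : probability R R) :=
  forall f : R -> R, continuous f -> (forall x, 0 <= f x) ->
  (\int[mu 0%N]_x (f x)%:E = \int[m]_x (f x)%:E)%E /\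
  forall k, (\int[mu k.+1]_x (f x)%:E =
    \int[m]_y \int[mu k]_x (f (x + y))%:E)%E.

(** Induction on k through the mixed term with [nu k] and last summand of law [m]: passing from
    [mu k] to [nu k] costs [e *+ k.+1], passing from [m] to [n] costs [e]. Uniformity in the
    translation b absorbs the variables held fixed. *)
Lemma convolves_dist (R : realType)
    (mu nu : nat -> probability R R)
    (m n : probability R R) (f : R -> R) (e : R) :
  convolves mu m -> convolves nu n ->
  continuous f -> (forall x, 0 <= f x <= 1) ->
  (forall b, `|\int[m]_x f (x + b) - \int[n]_x f (x + b)| <= e) ->
  forall k b, `|\int[mu k]_x f (x + b) - \int[nu k]_x f (x + b)| <= e *+ k.+1.
Proof.
move=> mum nun cf f01 fe.
have uf : unit_valued f by split=> //; exact: continuous_measurable_fun.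
have cfb b : continuous (fun x => f (x + b)).
  move=> x; apply: continuous_comp; last exact: cf.
  by apply: cvgD; [exact: cvg_id|exact: cvg_cst].
have fb0 b x : 0 <= f (x + b) by have /andP[] := f01 (x + b).
elim=> [|k IH] b.
  rewrite mulr1n /Rintegral.
  have [-> _] := mum _ (cfb b) (fb0 b).
  by have [-> _] := nun _ (cfb b) (fb0 b); exact: fe.
have convE (mu' : nat -> probability R R) m' : convolves mu' m' ->
    \int[mu' k.+1]_x f (x + b) = \int[m']_y \int[mu' k]_x f (x + y + b).
  move=> h; rewrite /Rintegral.
  have [_ ->] := h _ (cfb b) (fb0 b).
  congr fine; apply: eq_integral => y _.
  rewrite -unit_valued_EFin//.
  by under eq_fun do rewrite -addrA; exact: unit_valued_translate.
rewrite (convE mu m)// (convE nu n)//.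
have uc (mu' : probability R R) :
    unit_valued (fun y => \int[mu']_x f (x + y + b)).
  exact: (unit_valued_convolution mu' (unit_valued_translate b uf)).
have h1 : `|\int[m]_y \int[mu k]_x f (x + y + b) -
    \int[m]_y \int[nu k]_x f (x + y + b)| <= e *+ k.+1.
  apply: unit_valued_dist => // y.
  under eq_Rintegral do rewrite -addrA.
  by under [X in _ - X]eq_Rintegral do rewrite -addrA.
have h2 : `|\int[m]_y \int[nu k]_x f (x + y + b) -
    \int[n]_y \int[nu k]_x f (x + y + b)| <= e.
  have ufb := unit_valued_translate b uf.
  (* With the integral against [nu k] outermost, its variable x is fixed and x + b is the
     translation to which [fe] applies. *)
  rewrite -(unit_valued_Fubini (nu k) m ufb) -(unit_valued_Fubini (nu k) n ufb).
  have swap (m' : probability R R) (x : R) : \int[m']_y f (x + y + b) = \int[m']_y f (y + (x + b)).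
    by apply: eq_Rintegral => y _; rewrite addrAC addrC.
  under eq_Rintegral do rewrite swap.
  under [X in _ - X]eq_Rintegral do rewrite swap.
  have uc' (m' : probability R R) : unit_valued (fun x => \int[m']_y f (y + (x + b))).
    by have [? ?] := unit_valued_translate b (unit_valued_convolution m' uf).
  by apply: unit_valued_dist => // x.
rewrite -(subrKA (\int[m]_y \int[nu k]_x f (x + y + b))) mulrSr.
by apply: le_trans (ler_normD _ _) _; exact: lerD h1 h2.
Qed.

Lemma sqr_integrable d (T : measurableType d) (R : realType)
    (P : probability T R) (f : T -> R) (C : R) : measurable_fun setT f ->
  (\int[P]_x (f x ^+ 2)%:E = C%:E)%E ->
  P.-integrable setT (fun x => (f x ^+ 2)%:E).
Proof.
move=> mf fC; apply/integrableP; split.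
  exact/measurable_EFinP/measurable_funX.
by under eq_integral do rewrite gee0_abs ?lee_fin ?sqr_ge0//; rewrite fC ltry.
Qed.

(** From |t| <= 1 + t^2, the measure being finite. *)
Lemma sqr_integrable_integrable d (T : measurableType d) (R : realType)
    (P : probability T R) (f : T -> R) (C : R) : measurable_fun setT f ->
  (\int[P]_x (f x ^+ 2)%:E = C%:E)%E -> P.-integrable setT (EFin \o f).
Proof.
move=> mf fC.
apply: (@le_integrable _ _ _ P _ _ _
  ((EFin \o cst 1%R) \+ (fun x => (f x ^+ 2)%:E))%E) => //.
- exact/measurable_EFinP.
- move=> x _; rewrite /= lee_fin [leRHS]ger0_norm ?addr_ge0 ?sqr_ge0//.
  rewrite -(real_normK (num_real (f x))); have := sqr_ge0 (`|f x| - 1); nra.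
- apply: integrableD => //; first exact: (finite_measure_integrable_cst P).
  exact: sqr_integrable fC.
Qed.

Definition centered (R : realType) (m : probability R R)
    (s : R) :=
  (\int[m]_x x%:E = 0)%E /\ (\int[m]_x (x ^+ 2)%:E = (s ^+ 2)%:E)%E.

Section lindeberg.
Context {R : realType} (m : probability R R) (s : R).
Hypothesis ms : centered m s.

Let centered_integrable_sqr : m.-integrable setT (fun x : R => (x ^+ 2)%:E).
Proof. by have [_] := ms; exact: sqr_integrable. Qed.

Let centered_integrable_id : m.-integrable setT (EFin \o id).
Proof. by have [_] := ms; exact: sqr_integrable_integrable. Qed.

(** The shape of the Taylor remainder. The square makes it integrable with second moments only; the
    cube makes it negligible against the square for small x. *)
Definition lindeberg_term (x : R) := Num.min (x ^+ 2) (`|x| ^+ 3).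

Lemma lindeberg_term_ge0 x : 0 <= lindeberg_term x.
Proof. by rewrite le_min sqr_ge0 exprn_ge0. Qed.

Lemma measurable_lindeberg_term (c : R) :
  measurable_fun setT (fun y : R => lindeberg_term (c * y)).
Proof.
apply: measurable_minr.
  exact: measurable_funX.
by apply: measurable_funX; apply: measurableT_comp.
Qed.

Lemma integrable_lindeberg_term (c : R) :
  m.-integrable setT (fun y : R => (lindeberg_term (c * y))%:E).
Proof.
apply: (@le_integrable _ _ _ m _ _ _ (fun x => (c ^+ 2)%:E * (x ^+ 2)%:E)%E) => //.
- by apply/measurable_EFinP; exact: measurable_lindeberg_term.
- move=> x _; rewrite -EFinM/= lee_fin ger0_norm ?lindeberg_term_ge0//.
  by rewrite -exprMn ger0_norm ?sqr_ge0// ge_min lexx.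
- by apply: integrableZl => //; exact: centered_integrable_sqr.
Qed.

Lemma logistic_affine_unit_valued (b c : R) :
  unit_valued (fun y => logistic (b + c * y)).
Proof.
split=> [|x]; last by rewrite !ltW ?logistic_gt0 ?logistic_lt1.
apply: measurableT_comp.
  by apply: continuous_measurable_fun; exact: continuous_logistic.
by apply: measurable_funD => //; exact: measurable_funM.
Qed.

(** Taylor's formula is integrated in y: the linear term vanishes by centering and the quadratic one
    depends on [m] only through [s]. The main term is thus shared by all laws with the same first
    two moments. *)
Lemma logistic_step b c :
  `|\int[m]_y logistic (b + c * y) -
    (logistic b + d2logistic b / 2 * (c ^+ 2 * s ^+ 2))| <=
  4 * \int[m]_y lindeberg_term (c * y).
Proof.
have i1 : m.-integrable setT (EFin \o (fun=> logistic b)).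
  exact: (finite_measure_integrable_cst m).
have i2 : m.-integrable setT (EFin \o (fun y : R => dlogistic b * c * y)).
  rewrite /comp; under eq_fun do rewrite EFinM.
  by apply: integrableZl => //; exact: centered_integrable_id.
have i3 : m.-integrable setT
    (EFin \o (fun y : R => d2logistic b / 2 * c ^+ 2 * y ^+ 2)).
  rewrite /comp; under eq_fun do rewrite EFinM.
  by apply: integrableZl => //; exact: centered_integrable_sqr.
have i12 : m.-integrable setT
    (EFin \o (fun y : R => logistic b + dlogistic b * c * y)).
  by rewrite /comp; under eq_fun do rewrite EFinD; exact: integrableD.
have i123 : m.-integrable setT (EFin \o (fun y : R =>
    logistic b + dlogistic b * c * y + d2logistic b / 2 * c ^+ 2 * y ^+ 2)).
  by rewrite /comp; under eq_fun do rewrite EFinD; exact: integrableD.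
have -> : logistic b + d2logistic b / 2 * (c ^+ 2 * s ^+ 2) =
    \int[m]_y (logistic b + dlogistic b * c * y +
               d2logistic b / 2 * c ^+ 2 * y ^+ 2).
  rewrite !RintegralD// Rintegral_prob_cst !RintegralZl//.
  by rewrite /Rintegral; have [-> ->] := ms; rewrite /= mulr0 addr0 mulrA.
have il : m.-integrable setT (EFin \o (fun y : R => logistic (b + c * y))).
  by apply: unit_valued_integrable; exact: logistic_affine_unit_valued.
have ilB : m.-integrable setT (EFin \o (fun y : R => logistic (b + c * y) -
    (logistic b + dlogistic b * c * y + d2logistic b / 2 * c ^+ 2 * y ^+ 2))).
  by rewrite /comp; under eq_fun do rewrite EFinB; exact: integrableB.
rewrite -RintegralB//; apply: le_trans (le_normr_Rintegral _ _) _ => //.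
rewrite -RintegralZl//; last exact: integrable_lindeberg_term.
apply: le_Rintegral => //.
- exact: integrable_norm ilB.
- rewrite /comp; under eq_fun do rewrite EFinM.
  by apply: integrableZl => //; exact: integrable_lindeberg_term.
move=> y _; have := logistic_taylor_le b (c * y).
rewrite (_ : logistic_taylor b (c * y) = logistic b + dlogistic b * c * y +
  d2logistic b / 2 * c ^+ 2 * y ^+ 2)//.
by rewrite /logistic_taylor exprMn !mulrA.
Qed.

(** Dominated convergence: times n + 1, the square branch gives the bound a^2 y^2, free of n, and
    the cube branch gives |a y|^3 / sqrt(n + 1), which tends to 0 for each y. *)
Lemma lindeberg_cvg0 (a : R) :
  n.+1%:R * \int[m]_y lindeberg_term (a / Num.sqrt n.+1%:R * y)
  @[n --> \oo] --> 0.
Proof.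
pose h (n : nat) (y : R) := (n.+1%:R * lindeberg_term (a / Num.sqrt n.+1%:R * y))%:E.
have hle n (y : R) : n.+1%:R * lindeberg_term (a / Num.sqrt n.+1%:R * y) <=
    a ^+ 2 * y ^+ 2.
  rewrite -ler_pdivlMl ?ltr0n// ge_min; apply/orP; left.
  by rewrite exprMn expr_div_n sqr_sqrtr ?ler0n// [leRHS]mulrA [a ^+ 2 / _]mulrC.
have h0 n (y : R) : 0 <= n.+1%:R * lindeberg_term (a / Num.sqrt n.+1%:R * y).
  by rewrite mulr_ge0 ?ler0n ?lindeberg_term_ge0.
have hle3 n (y : R) : n.+1%:R * lindeberg_term (a / Num.sqrt n.+1%:R * y) <=
    `|a * y| ^+ 3 / Num.sqrt n.+1%:R.
  have sn : 0 < Num.sqrt n.+1%:R :> R by rewrite sqrtr_gt0 ltr0n.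
  rewrite -ler_pdivlMl ?ltr0n// ge_min; apply/orP; right.
  rewrite !normrM normfV (gtr0_norm sn).
  move: sn; set r := Num.sqrt _ => sn.
  have -> : n.+1%:R = r ^+ 2 by rewrite sqr_sqrtr ?ler0n.
  by rewrite le_eqVlt; apply/orP; left; apply/eqP; field; rewrite gt_eqF.
have [] := @dominated_convergence _ _ R m setT measurableT h
  (cst 0%E) (fun y => ((a ^+ 2)%:E * (y ^+ 2)%:E))%E.
- move=> n; apply/measurable_EFinP/measurable_funM => //.
  exact: measurable_lindeberg_term.
- exact: measurable_cst.
- apply: aeW => y _; apply/fine_cvgP; split; first exact: nearW.
  apply: (@squeeze_cvgr _ _ _ _ (cst 0) (fun n => `|a * y| ^+ 3 / Num.sqrt n.+1%:R)).
  + by apply: nearW => n; rewrite /= h0 hle3.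
  + exact: cvg_cst.
  + rewrite -[X in _ --> X](mulr0 (`|a * y| ^+ 3)).
    apply: cvgM; first exact: cvg_cst.
    rewrite -sqrtr0; under eq_fun do rewrite -sqrtrV ?ler0n//.
    apply: continuous_cvg; first exact: sqrt_continuous.
    exact: cvg_harmonic.
- by apply: integrableZl => //; exact: centered_integrable_sqr.
- apply: aeW => y n _; rewrite -EFinM /h /= lee_fin ger0_norm//.
move=> _ _; rewrite integral_cst// mul0e.
move=> /fine_cvgP[_]; apply: cvg_trans; apply: near_eq_cvg; apply: nearW => n.
rewrite /= -RintegralZl//.
exact: integrable_lindeberg_term.
Qed.

End lindeberg.

(** One exchange costs at most [e k], by [logistic_step] for both laws around their common main
    term. [convolves_dist] adds up k + 1 such costs, and [lindeberg_cvg0] makes the total vanish. *)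
Lemma logistic_clt (R : realType)
    (mu nu : nat -> probability R R)
    (m n : probability R R) (s : R) :
  convolves mu m -> convolves nu n -> centered m s -> centered n s ->
  forall a b,
  \int[mu k]_x logistic (b + a / Num.sqrt k.+1%:R * x) -
  \int[nu k]_x logistic (b + a / Num.sqrt k.+1%:R * x) @[k --> \oo] --> 0.
Proof.
move=> mum nun ms ns a b.
pose e k := 4 * (\int[m]_y lindeberg_term (a / Num.sqrt k.+1%:R * y) +
                 \int[n]_y lindeberg_term (a / Num.sqrt k.+1%:R * y)).
apply/norm_cvg0P.
apply: (@squeeze_cvgr _ _ _ _ (cst 0) (fun k => e k *+ k.+1)).
- apply: nearW => k; rewrite normr_ge0/=.
  set c := a / _; pose f x := logistic (b + c * x).
  have := @convolves_dist R mu nu m n f (e k) mum nun.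
  have cf : continuous f.
    move=> x; apply: (@continuous_comp _ _ _ (fun x => b + c * x) logistic).
      by apply: cvgD; [exact: cvg_cst|apply: cvgM; [exact: cvg_cst|exact: cvg_id]].
    exact: continuous_logistic.
  have [_ f01] := logistic_affine_unit_valued b c.
  move=> /(_ cf f01) h.
  have /h/(_ k 0) : forall b', `|\int[m]_x f (x + b') - \int[n]_x f (x + b')| <= e k.
    (* A translation by b' only moves the centre of the expansion, and [logistic_step] is uniform in
       the centre. *)
    move=> b'; set z := b + c * b'.
    have fE x : f (x + b') = logistic (z + c * x).
      by rewrite /f mulrDr addrCA addrC -/z.
    under eq_Rintegral do rewrite fE.
    under [X in _ - X]eq_Rintegral do rewrite fE.
    have := logistic_step ms z c; have := logistic_step ns z c.
    set u := \int[m]_x _; set v := \int[n]_x _; set w := _ + _ / _ * _.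
    rewrite /e -/c mulrDr => vw uw.
    rewrite -(subrKA w); apply: le_trans (ler_normD _ _) _.
    by rewrite lerD// distrC.
  under eq_Rintegral do rewrite addr0.
  by under [X in _ - X]eq_Rintegral do rewrite addr0.
- exact: cvg_cst.
- have -> : (fun k => e k *+ k.+1) = (fun k => 4 *
     (k.+1%:R * \int[m]_y lindeberg_term (a / Num.sqrt k.+1%:R * y) +
      k.+1%:R * \int[n]_y lindeberg_term (a / Num.sqrt k.+1%:R * y))).
    by apply/funext => k; rewrite /e -mulr_natl mulrCA mulrDr.
  rewrite -[X in _ --> X](mulr0 4) -(addr0 0).
  apply: cvgM; first exact: cvg_cst.
  by apply: cvgD; apply: lindeberg_cvg0; eassumption.
Qed.

(** * Laws of partial sums *)

Section partial_sums.
Context {R : realType} d (T : measurableType d) (P : probability T R).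
Variable X : nat -> {RV P >-> R}.

Definition partial_sum (n : nat) : T -> R := fun w => \sum_(i < n) X i w.

Lemma measurable_partial_sum n : measurable_fun setT (partial_sum n).
Proof. by apply: measurable_sum => i; exact: measurable_funP. Qed.

HB.instance Definition _ n := isMeasurableFun.Build _ _ _ _
  (partial_sum n) (measurable_partial_sum n).

Hypothesis indep : mutually_independent X.

Let cylinder (J : {fset nat}) (B : nat -> set R) : set T :=
  \bigcap_(i in [set` J]) (X i @^-1` B i).

Let measurable_preim (f : {RV P >-> R}) (A : set R) : measurable A ->
  measurable (f @^-1` A).
Proof. by move=> mA; rewrite -[f @^-1` A]setTI; exact: measurable_funP. Qed.

Let measurable_cylinder J B : (forall i, i \in J -> measurable (B i)) ->
  measurable (cylinder J B).
Proof.
move=> mB; apply: fin_bigcap_measurable; first exact: finite_fset.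
by move=> i iJ; apply: measurable_preim; exact: mB.
Qed.

Let cylinderU1 (J : {fset nat}) B k A : k \notin J ->
  cylinder (k |` J)%fset (fun i => if i == k then A else B i) =
  X k @^-1` A `&` cylinder J B.
Proof.
move=> kJ; apply/seteqP; split=> w /=.
- move=> h; split=> [|i iJ].
    by have := h k; rewrite /= fset1U1 eqxx; exact.
  have := h i; rewrite /= in_fset1U (_ : i \in J)//= orbT; move=> /(_ isT).
  by case: eqP => // ik; move: kJ; rewrite -ik => /negP.
- move=> [hk hJ] i /=; rewrite in_fset1U; case: eqP => [->//|_ /= iJ].
  exact: hJ.
Qed.

Let cylinder_indep (J : {fset nat}) B k A : k \notin J -> measurable A ->
  (forall i, i \in J -> measurable (B i)) ->
  P (X k @^-1` A `&` cylinder J B) = (P (X k @^-1` A) * P (cylinder J B))%E.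
Proof.
move=> kJ mA mB; rewrite -cylinderU1// /cylinder !indep//; last first.
  move=> i; rewrite in_fset1U; case: eqP => //= _; exact: mB.
rewrite big_fsetU1//= eqxx; congr (_ * _)%E.
rewrite big_seq [RHS]big_seq; apply: eq_bigr => i iJ.
by case: eqP => // ik; move: kJ; rewrite -ik iJ.
Qed.

Let pair k (w : T) := (partial_sum k w, X k w).

Let measurable_pair k : measurable_fun setT (pair k).
Proof. by apply: measurable_fun_pair. Qed.

Let psum k : {RV P >-> R} := partial_sum k.

(* The cylinder over later coordinates is what makes the induction on k work:
   at each step one of its coordinates is moved into the sum. *)
Let partial_sum_indep_at k := forall (J : {fset nat}) B (A : set R),
  (forall i, i \in J -> (k <= i)%N) -> (forall i, i \in J -> measurable (B i)) ->
  measurable A ->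
  P (partial_sum k @^-1` A `&` cylinder J B) =
  (P (partial_sum k @^-1` A) * P (cylinder J B))%E.

(** Two measures on the plane are compared: the law of [pair k] restricted to the cylinder event,
    and the product law scaled by the probability of that event. On a rectangle, the condition on
    [X k] joins the cylinder and [indk] applies; uniqueness of product measures does the rest. *)
Let joint_law_cylinder k : partial_sum_indep_at k -> forall (J : {fset nat}) B C,
  (forall i, i \in J -> (k < i)%N) -> (forall i, i \in J -> measurable (B i)) ->
  measurable C ->
  P (pair k @^-1` C `&` cylinder J B) =
  (P (cylinder J B) * (distribution P (psum k) \x distribution P (X k)) C)%E.
Proof.
move=> indk J B C Jk mB mC.
have mE := measurable_cylinder mB.
pose r : {nonneg R} := NngNum (fine_ge0 (measure_ge0 P (cylinder J B))).
have rE : (r%:num)%:E = P (cylinder J B) by rewrite /= fineK// fin_num_measure.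
pose m1 := mscale r (distribution P (psum k)).
(* The measure structure of [pushforward] depends on a measurability proof, so
   it is not inferred. *)
pose m' : {measure set (R * R) -> \bar R} :=
  measure_function_pushforward__canonical__measure_function_Measure
   (mrestr P mE) (measurable_pair k).
have kJ : k \notin J by apply/negP => /Jk; rewrite ltnn.
have := @product_measure_unique _ _ _ _ _ m1 (distribution P (X k)) m' _ C mC.
rewrite -rE /product_measure1 ge0_integral_mscale//; last first.
  exact: measurable_fun_xsection.
move=> h; rewrite {}h//.
move=> A1 A2 mA1 mA2.
rewrite /m'/= /pushforward /mrestr /m1/= /mscale /= -[fine _]/(r%:num) rE.
rewrite (_ : pair k @^-1` (A1 `*` A2) `&` cylinder J B =
  partial_sum k @^-1` A1 `&` cylinder (k |` J)%fset
    (fun i => if i == k then A2 else B i)); last first.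
  by rewrite cylinderU1// setIA; congr (_ `&` _); apply/seteqP; split=> w.
rewrite indk//; last 2 first.
- by move=> i; rewrite in_fset1U => /predU1P[->//|/Jk/ltnW].
- by move=> i; rewrite in_fset1U; case: eqP => //= _; exact: mB.
rewrite cylinderU1// cylinder_indep// muleA muleC muleA.
by rewrite /distribution /pushforward /= /preimage/=.
Qed.

Let joint_law_indep k C : partial_sum_indep_at k -> measurable C ->
  P (pair k @^-1` C) = ((distribution P (psum k) \x distribution P (X k)) C)%E.
Proof.
move=> indk mC; have := @joint_law_cylinder k indk fset0 (fun=> setT) C.
rewrite (_ : cylinder fset0 _ = setT); last by apply/seteqP; split.
by rewrite setIT probability_setT mul1e; apply.
Qed.

(** The empty sum is constant, so its events are trivial. At the next step the sum is a function of
    [pair k], whose joint law is a product both on the cylinder and on the whole space. *)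
Let partial_sum_indep k : partial_sum_indep_at k.
Proof.
elim: k => [|k IH] J B A Jk mB mA.
  have [A0|A0] := pselect (A 0).
    rewrite (_ : partial_sum 0 @^-1` A = setT); last first.
      by apply/seteqP; split=> // w _; rewrite /preimage/= /partial_sum big_ord0.
    by rewrite setTI probability_setT mul1e.
  rewrite (_ : partial_sum 0 @^-1` A = set0); last first.
    by apply/seteqP; split=> // w; rewrite /preimage/= /partial_sum big_ord0.
  by rewrite set0I measure0 mul0e.
pose C := [set z : R * R | A (z.1 + z.2)].
have mC : measurable C.
  have madd : measurable_fun setT (fun z : R * R => z.1 + z.2).
    by apply: measurable_funD; [exact: measurable_fst|exact: measurable_snd].
  by have := madd measurableT A mA; rewrite setTI.
have -> : partial_sum k.+1 @^-1` A = pair k @^-1` C.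
  apply/seteqP; split=> w;
  by rewrite /preimage/= /partial_sum big_ord_recr.
rewrite joint_law_cylinder//.
by rewrite joint_law_indep// muleC.
Qed.

Let joint_law k C : measurable C ->
  P (pair k @^-1` C) = ((distribution P (psum k) \x distribution P (X k)) C)%E.
Proof. by apply: joint_law_indep; exact: partial_sum_indep. Qed.

(** Tonelli turns the iterated integral into one over the product law, which by [joint_law] is the
    image of [P] under [pair k]. *)
Lemma partial_sumS_integral k (f : R -> \bar R) :
  measurable_fun setT f -> (forall x, 0 <= f x)%E ->
  (\int[distribution P (psum k.+1)]_x f x =
   \int[distribution P (X k)]_y \int[distribution P (psum k)]_x f (x + y)%R)%E.
Proof.
move=> mf f0.
have madd : measurable_fun setT (fun z : R * R => z.1 + z.2).
  by apply: measurable_funD; [exact: measurable_fst|exact: measurable_snd].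
have mg : measurable_fun setT (fun z : R * R => f (z.1 + z.2)).
  exact: measurableT_comp.
rewrite -(@fubini_tonelli2 _ _ _ _ _ _ _ (fun z : R * R => f (z.1 + z.2)))//.
rewrite ge0_integral_distribution//.
pose m' : {measure set (R * R) -> \bar R} :=
  measure_function_pushforward__canonical__measure_function_Measure
    P (measurable_pair k).
rewrite [RHS](eq_measure_integral m'); last first.
  by move=> C mC _; apply/esym; exact: joint_law.
rewrite [RHS]ge0_integral_pushforward//.
by apply: eq_integral => w _; rewrite /= /partial_sum big_ord_recr.
Qed.
End partial_sums.

Section partial_sum_laws.
Context {R : realType} d (T : measurableType d) (P : probability T R).
Variables (X : nat -> {RV P >-> R}).

(** The shift by one agrees with [convolves], where index k stands for k + 1 summands. *)
Definition partial_sum_law (k : nat) : probability R R :=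
  distribution P (partial_sum X k.+1 : {RV P >-> R}).

Lemma convolves_partial_sum : mutually_independent X ->
  identically_distributed X -> convolves partial_sum_law (distribution P (X 0%N)).
Proof.
move=> indX idX f cf f0.
have mf : measurable_fun setT (EFin \o f).
  by apply/measurable_EFinP; exact: continuous_measurable_fun.
have f0' x : (0 <= (EFin \o f) x)%E by rewrite lee_fin.
split.
  rewrite [LHS]ge0_integral_distribution// [RHS]ge0_integral_distribution//.
  by apply: eq_integral => w _; rewrite /= /partial_sum big_ord1.
move=> k; rewrite [LHS](partial_sumS_integral indX k.+1 mf)//.
by apply: eq_measure_integral => A mA _; exact: idX.
Qed.

End partial_sum_laws.

(** * Normal laws as laws of sums *)

Section normal_law.
Context {R : realType}.

Let id_borel : measurableTypeR R -> R := idfun.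

#[local] HB.instance Definition _ :=
  @isMeasurableFun.Build _ _ _ _ id_borel (@measurable_id _ _ setT).

(* The library's [normal_prob] lives on [measurableTypeR R], whose display
   differs from the one of the codomain [R] of random variables. *)
Definition normal_law (s : R) : probability R R :=
  distribution (normal_prob 0 s) (id_borel : {RV (normal_prob 0 s) >-> R}).

Lemma normal_lawE s (A : set R) : normal_law s A = normal_prob 0 s A.
Proof. by []. Qed.

Lemma ge0_integral_normal_law s (f : R -> \bar R) :
  measurable_fun setT f -> (forall x, 0 <= f x)%E ->
  (\int[normal_law s]_x f x = \int[normal_prob 0 s]_x f x)%E.
Proof.
by move=> mf f0; rewrite (@ge0_integral_distribution _ _ _ _ _ _
  (id_borel : {RV (normal_prob 0 s) >-> R}) f mf f0).
Qed.

(** Variances add: s^2 + s^2 (k + 1) = s^2 (k + 2), and [normal_prob_conv] applies. *)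
Lemma convolves_normal (s : R) : 0 < s ->
  convolves (fun k => normal_law (s * Num.sqrt k.+1%:R)) (normal_law s).
Proof.
move=> s0 f cf f0.
have mf : measurable_fun setT f by exact: continuous_measurable_fun.
split=> [|k].
  by rewrite sqrtr1 mulr1.
have sk : 0 < s * Num.sqrt k.+1%:R by rewrite mulr_gt0// sqrtr_gt0 ltr0n.
rewrite (_ : s * Num.sqrt k.+2%:R =
    Num.sqrt (s ^+ 2 + (s * Num.sqrt k.+1%:R) ^+ 2)); last first.
  rewrite exprMn sqr_sqrtr ?ler0n//.
  have -> : s ^+ 2 + s ^+ 2 * k.+1%:R = s ^+ 2 * k.+2%:R.
    by rewrite -[k.+2]add1n natrD mulrDr mulr1.
  by rewrite sqrtrM ?sqr_ge0// sqrtr_sqr gtr0_norm.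
have mfE : measurable_fun setT (fun x => (f x)%:E) by exact/measurable_EFinP.
have fE0 x : (0 <= (f x)%:E)%E by rewrite lee_fin.
rewrite [LHS](ge0_integral_normal_law _ mfE fE0).
rewrite [LHS](normal_prob_conv (lt0r_neq0 s0) (lt0r_neq0 sk) cf f0).
rewrite [RHS]ge0_integral_normal_law.
- apply: eq_integral => y _; rewrite ge0_integral_normal_law//.
  + by apply: eq_integral => x _; rewrite addrC.
  + by apply/measurable_EFinP/measurableT_comp => //; exact: measurable_funD.
- pose k' (z : R * R) : \bar R := (f (z.2 + z.1))%:E.
  apply: (@measurable_fun_fubini_tonelli_F _ _ _ _ _ _ k') => //.
  + apply/measurable_EFinP/measurableT_comp => //; apply: measurable_funD.
      exact: measurable_snd.
    exact: measurable_fst.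
  + by move=> z; exact: fE0.
- by move=> y; apply: integral_ge0 => x _.
Qed.

Lemma centered_normal_law (s : R) : s != 0 -> centered (normal_law s) s.
Proof.
move=> s0; split; last first.
  rewrite ge0_integral_normal_law ?normal_prob_sqr//.
  - exact/measurable_EFinP/measurable_funX.
  - by move=> x; rewrite lee_fin sqr_ge0.
rewrite -[RHS](normal_prob_mean s0).
rewrite (@integral_distribution _ _ _ _ _ _
  (id_borel : {RV (normal_prob 0 s) >-> R}) EFin)//.
apply: (@integrable_normal_prob _ 0 s (fun x => x%:E)).
  exact/measurable_EFinP.
exact: integrable_id_normal_pdf.
Qed.

End normal_law.

(** * Convergence of distribution functions *)

(** Substitution y = c u; the derivative c cancels against the factor c in the peak of the
    density. *)
Lemma normal_prob_scale (R : realType) (s c : R) (f : R -> R) :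
  s != 0 -> 0 < c -> continuous f -> (forall x, 0 <= f x) ->
  (\int[normal_prob 0 (s * c)]_x (f x)%:E =
   \int[normal_prob 0 s]_x (f (c * x))%:E)%E.
Proof.
move=> s0 c0 cf f0.
have mf : measurable_fun setT f by exact: continuous_measurable_fun.
have sc0 : s * c != 0 by rewrite mulf_neq0// gt_eqF.
rewrite integral_normal_prob; last exact/measurable_EFinP.
rewrite integral_normal_prob; last first.
  by apply/measurable_EFinP/measurableT_comp => //; exact: measurable_funM.
under eq_integral do rewrite -EFinM.
have dE : ((fun u : R => c * u)^`())%classic = cst c.
  apply/funext => u; rewrite derive1E.
  by rewrite (_ : (fun _ => _) = c \*: id)// deriveZ// derive_id /GRing.scale/= mulr1.
rewrite (@increasing_ge0_integration_by_substitutionT _ (fun u => c * u)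
  (fun y => f y * normal_pdf 0 (s * c) y))//; rewrite ?dE.
- apply: eq_integral => u _; rewrite fctE/= -EFinM -mulrA; congr (_ * _)%:E.
  rewrite !normal_pdfE//= mulrAC; congr (_ * _).
    rewrite /normal_peak exprMn (_ : _ *+ 2 = c ^+ 2 * (s ^+ 2 * pi *+ 2)); last by ring.
    rewrite sqrtrM ?sqr_ge0// sqrtr_sqr gtr0_norm// invfM mulrC mulrA.
    by rewrite mulfV ?mul1r// gt_eqF.
  by rewrite /normal_fun; congr expR; field; rewrite s0 gt_eqF.
- by move=> a b ab; rewrite ltr_pM2l.
- by move=> a; exact: cvg_cst.
- exact: is_cvg_cst.
- exact: is_cvg_cst.
- by apply/gt0_cvgMrNy => //; exact: cvg_id.
- by apply/gt0_cvgMry => //; exact: cvg_id.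
- by move=> y; apply: cvgM; [exact: cf|exact: continuous_normal_pdf].
- by move=> y; rewrite mulr_ge0 ?normal_pdf_ge0.
Qed.

Section logistic_cdf.
Context {R : realType}.
Implicit Types (m : probability R R) (x y u : R).

Definition rcdf m x : R := fine (m `]-oo, x]%classic).

Lemma rcdfE m x : (rcdf m x)%:E = m `]-oo, x]%classic.
Proof. by rewrite /rcdf fineK// fin_num_measure. Qed.

Lemma rcdf_ge0 m x : 0 <= rcdf m x.
Proof. by rewrite /rcdf fine_ge0. Qed.

Lemma rcdf_le1 m x : rcdf m x <= 1.
Proof. by rewrite -lee_fin rcdfE probability_le1. Qed.

Lemma Rintegral_indic_itv m x :
  \int[m]_t (\1_(`]-oo, x]%classic) t : R) = rcdf m x.
Proof. by rewrite /Rintegral integral_indic// setIT. Qed.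

Lemma logistic_opp x : logistic (- x) = 1 - logistic x.
Proof.
rewrite /logistic expRN; have e0 := expR_gt0 x; set e := expR x in e0 *.
by field; rewrite !gt_eqF ?addr_gt0.
Qed.

Lemma ler_logistic x y : x <= y -> logistic y <= logistic x.
Proof.
by move=> xy; rewrite lef_pV2 ?posrE ?addr_gt0 ?expR_gt0// lerD2l ler_expR.
Qed.

Let indic_unit x : unit_valued (\1_(`]-oo, x]%classic) : R -> R).
Proof.
split=> [|t]; first exact: measurable_indic.
by rewrite indicE; case: (_ \in _); rewrite ?ler01 ?lexx.
Qed.

(** The logistic function is centred at the midpoint of x and y. For t <= x it is at least 1 -
    [logistic (a * d)], for t > y at most [logistic (a * d)]; elsewhere the bounds 0 and 1
    suffice. *)
Lemma logistic_sandwich m x y a (d := (y - x) / 2) : x < y -> 0 < a ->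
  rcdf m x - logistic (a * d) <=
    \int[m]_t logistic (- (a * ((x + y) / 2)) + a * t) <=
  rcdf m y + logistic (a * d).
Proof.
move=> xy a0.
have ul := logistic_affine_unit_valued (- (a * ((x + y) / 2))) a.
have il := unit_valued_integrable m ul.
have ii z := unit_valued_integrable m (indic_unit z).
have ic : m.-integrable setT (EFin \o cst (logistic (a * d))).
  exact: (finite_measure_integrable_cst m).
have d0 : 0 < d by rewrite divr_gt0// subr_gt0.
have e0 := logistic_gt0 (a * d); have e1 := logistic_lt1 (a * d).
rewrite -!Rintegral_indic_itv -[logistic (a * d)](Rintegral_prob_cst m).
apply/andP; split.
- rewrite -RintegralB//; apply: le_Rintegral => //.
    exact: (@integrableB _ _ _ m setT measurableT _ _ (ii x) ic).
  move=> t _; rewrite indicE; case: (boolP (t \in _)) => [|_].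
  - rewrite inE/= in_itv/= => tx; rewrite /= -logistic_opp ler_logistic//.
    rewrite /d; nra.
  - by rewrite sub0r (@le_trans _ _ 0) ?oppr_le0 ?ltW// logistic_gt0.
- rewrite -RintegralD//; apply: le_Rintegral => //.
    exact: (@integrableD _ _ _ m setT measurableT _ _ (ii y) ic).
  move=> t _; rewrite indicE; case: (boolP (t \in _)) => [_|].
  - by rewrite /= (le_trans (ltW (logistic_lt1 _)))// lerDl ltW.
  - rewrite notin_setE/= in_itv/= => /negP; rewrite -ltNge => yt.
    by rewrite add0r ler_logistic// /d; nra.
Qed.

Lemma logistic_small (d e : R) : 0 < d -> 0 < e ->
  exists2 a, 0 < a & logistic (a * d) < e.
Proof.
(* This choice makes a d = 1 / e, and 1 + exp(1 / e) >= 2 + 1 / e > 1 / e. *)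
move=> d0 e0; exists (1 / (d * e)); first by rewrite divr_gt0// mulr_gt0.
have -> : 1 / (d * e) * d = e^-1 by field; rewrite !gt_eqF.
rewrite /logistic invf_plt ?posrE ?addr_gt0 ?expR_gt0//.
rewrite (lt_le_trans _ (lerD (lexx 1) (expR_ge1Dx _)))//.
by rewrite addrA ltrDr.
Qed.

Variables (mu : nat -> probability R R) (m : probability R R).
Hypothesis mum : forall a b,
  \int[mu n]_t logistic (b + a * t) @[n --> \oo] --> \int[m]_t logistic (b + a * t).

Lemma rcdf_lt_near x y u : x < y -> rcdf m y < u ->
  \forall n \near \oo, rcdf (mu n) x < u.
Proof.
move=> xy yu.
have d0 : 0 < (y - x) / 2 by rewrite divr_gt0// subr_gt0.
(* One third for each error: the sandwich for [m], the sandwich for [mu n], and the distance of the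
   two integrals. *)
have e0 : 0 < (u - rcdf m y) / 3 by rewrite divr_gt0// subr_gt0.
have [a a0 ae] := logistic_small d0 e0.
have := @mum a (- (a * ((x + y) / 2))) => /cvgrPdist_lt/(_ _ e0).
apply: filterS => n.
have /andP[_ h1] := logistic_sandwich m xy a0.
have /andP[h2 _] := logistic_sandwich (mu n) xy a0.
by rewrite ltr_distl => /andP[h3 h4]; lra.
Qed.

Lemma rcdf_gt_near x y u : x < y -> u < rcdf m x ->
  \forall n \near \oo, u < rcdf (mu n) y.
Proof.
move=> xy xu.
have d0 : 0 < (y - x) / 2 by rewrite divr_gt0// subr_gt0.
have e0 : 0 < (rcdf m x - u) / 3 by rewrite divr_gt0// subr_gt0.
have [a a0 ae] := logistic_small d0 e0.
have := @mum a (- (a * ((x + y) / 2))) => /cvgrPdist_lt/(_ _ e0).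
apply: filterS => n.
have /andP[h1 _] := logistic_sandwich m xy a0.
have /andP[_ h2] := logistic_sandwich (mu n) xy a0.
by rewrite ltr_distl => /andP[h3 h4]; lra.
Qed.

End logistic_cdf.

(** In [logistic_clt] the scale 1 / sqrt(n + 1) is moved into the laws: the partial sum becomes the
    normalized sum ([E1]), and the normal law of the sum becomes the fixed law [normal_law s]
    ([E2]). *)
Lemma normalized_sum_logistic_clt (R : realType)
    (d : measure_display) (T : measurableType d) (P : probability T R)
    (X : nat -> {RV P >-> R}) (s : R) :
  mutually_independent X -> identically_distributed X ->
  centered (distribution P (X 0%N)) s -> 0 < s ->
  forall a b,
  \int[distribution P (normalized_sumRV X n)]_t logistic (b + a * t)
    @[n --> \oo] --> \int[normal_law s]_t logistic (b + a * t).
Proof.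
move=> indX idX cX s0 a b.
have h := logistic_clt (convolves_partial_sum indX idX) (convolves_normal s0) cX
  (centered_normal_law (lt0r_neq0 s0)) a b.
have mL (c : R) : measurable_fun setT (fun x : R => (logistic (b + c * x))%:E).
  by have [mf _] := logistic_affine_unit_valued b c; exact/measurable_EFinP.
have L0 (c x : R) : (0 <= (logistic (b + c * x))%:E)%E.
  by rewrite lee_fin ltW// logistic_gt0.
have cL (c : R) : continuous (fun x : R => logistic (b + c * x)).
  move=> x; apply: (@continuous_comp _ _ _ (fun x => b + c * x) logistic).
    by apply: cvgD; [exact: cvg_cst|apply: cvgM; [exact: cvg_cst|exact: cvg_id]].
  exact: continuous_logistic.
have sn n : 0 < Num.sqrt n.+1%:R :> R by rewrite sqrtr_gt0 ltr0n.
have E1 n : \int[partial_sum_law X n]_x logistic (b + a / Num.sqrt n.+1%:R * x) =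
    \int[distribution P (normalized_sumRV X n.+1)]_t logistic (b + a * t).
  apply: (congr1 fine).
  rewrite [LHS](ge0_integral_distribution _ (mL (a / Num.sqrt n.+1%:R)) (L0 _)).
  rewrite [RHS](ge0_integral_distribution _ (mL a) (L0 _)).
  apply: eq_integral => w _ /=; congr (logistic (_ + _))%:E.
  by rewrite /partial_sum /normalized_sum -mulrA (mulrC _^-1).
have E2 n : \int[normal_law (s * Num.sqrt n.+1%:R)]_x
      logistic (b + a / Num.sqrt n.+1%:R * x) =
    \int[normal_law s]_t logistic (b + a * t).
  apply: (congr1 fine).
  rewrite [LHS](ge0_integral_normal_law _ (mL _) (L0 _)).
  rewrite [RHS](ge0_integral_normal_law _ (mL _) (L0 _)).
  rewrite [LHS](normal_prob_scale (lt0r_neq0 s0) (sn n) (cL _)); last first.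
    by move=> x; rewrite -lee_fin.
  by apply: eq_integral => x _; rewrite mulrA divfK// gt_eqF.
rewrite -cvg_shiftS; apply/subr_cvg0.
apply: cvg_trans h; apply: near_eq_cvg; apply: nearW => n.
exact: (f_equal2 (fun u v : R => u - v) (E1 n) (E2 n)).
Qed.

(** * Quantile coupling *)

(** The left half-lines are closed under intersection, generate the Borel sets and exhaust the
    line. *)
Lemma probability_eq_itv (R : realType) (m1 m2 : probability R R) :
  (forall x, m1 `]-oo, x]%classic = m2 `]-oo, x]%classic) ->
  forall A, measurable A -> m1 A = m2 A.
Proof.
move=> h A mA.
pose G : set (set R) := [set `]-oo, x]%classic | x in setT].
apply: (measure_unique G (fun n => `]-oo, n%:R]%classic)) => //.
- rewrite eqEsubset; split.
    rewrite [X in X `<=` _](RGenOInfty.measurableE R).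
    apply: smallest_sub; first exact: smallest_sigma_algebra.
    move=> _ [x ->]; rewrite -setCitvl.
    by apply: sigma_algebraC; apply: sub_sigma_algebra; exists x.
  apply: smallest_sub; first exact: sigma_algebra_measurable.
  by move=> _ [x _ <-]; exact: measurable_itv.
- move=> _ _ [x _ <-] [y _ <-]; exists (Num.min x y) => //.
  by apply/seteqP; split=> z /=; rewrite !in_itv/= le_min => /andP.
- by move=> n; exists n%:R.
- rewrite -subTset => x _; exists (Num.truncn x).+1 => //=.
  by rewrite in_itv/= ltW// truncnS_gt.
- by move=> _ [x _ <-]; exact: h.
- by move=> n; rewrite (le_lt_trans (probability_le1 _ _))// ltry.
Qed.

Section quantile.
Context {R : realType} (m : probability R R).
Implicit Types (u x : R).

Let id_R : R -> R := idfun.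

#[local] HB.instance Definition _ :=
  @isMeasurableFun.Build _ _ _ _ id_R (@measurable_id _ _ setT).

Let rcdf_cdf x : (rcdf m x)%:E = cdf (id_R : {RV m >-> R}) x.
Proof. by rewrite rcdfE. Qed.

Lemma rcdf_nondecreasing : {homo rcdf m : x y / x <= y}.
Proof. by move=> x y xy; rewrite -lee_fin !rcdf_cdf; exact: cdf_nondecreasing. Qed.

Let rcdf_right x : rcdf m y @[y --> x^'+] --> rcdf m x.
Proof.
have := @cdf_right_continuous _ _ _ m (id_R : {RV m >-> R}) x.
by rewrite -rcdf_cdf => /fine_cvgP[_].
Qed.

Let rcdf_gt u : u < 1 -> exists x, u <= rcdf m x.
Proof.
move=> u1; have := @cvg_cdfy1 _ _ _ m (id_R : {RV m >-> R}).
move=> /fine_cvgP[_] /cvgrPdist_lt/(_ (1 - u)).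
rewrite subr_gt0 => /(_ u1)[M [_ hM]]; exists (M + 1).
have := hM (M + 1); rewrite ltrDl ltr01 => /(_ isT).
by rewrite /= -[fine _]/(rcdf m (M + 1)) ltr_distl => /andP[]; lra.
Qed.

Let rcdf_lt u : 0 < u -> exists x, rcdf m x < u.
Proof.
move=> u0; have := @cvg_cdfNy0 _ _ _ m (id_R : {RV m >-> R}).
move=> /fine_cvgP[_] /cvgrPdist_lt/(_ _ u0)[M [_ hM]]; exists (M - 1).
have := hM (M - 1); rewrite ltrBlDr ltrDl ltr01 => /(_ isT).
by rewrite /= -[fine _]/(rcdf m (M - 1)) ltr_distl => /andP[]; lra.
Qed.

(** For u <= 0 the set is unbounded below and for u >= 1 it may be empty. The default 0 there is
    harmless, since the uniform law gives no mass to the complement of ]0, 1[. *)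
Definition quantile u : R :=
  if 0 < u < 1 then inf [set x | u <= rcdf m x] else 0.

(** The Galois connection between quantile and distribution function; it amounts to the infimum
    being attained. *)
Lemma quantile_le u x : 0 < u < 1 -> (quantile u <= x) = (u <= rcdf m x).
Proof.
move=> u01; have /andP[u0 u1] := u01; rewrite /quantile u01.
set S := [set x | u <= rcdf m x].
have S0 : S !=set0 by have [y uy] := rcdf_gt u1; exists y.
have Slb : has_lbound S.
  have [y uy] := rcdf_lt u0; exists y => z; rewrite /S/= => uz.
  rewrite leNgt; apply/negP => /ltW/rcdf_nondecreasing; lra.
apply/idP/idP => [Sx|ux]; last exact: (ge_inf Slb).
apply: le_trans _ (rcdf_nondecreasing Sx).
(* Any y to the right of [inf S] lies above some point of [S], so the distribution function is at
   least u at y; right continuity carries this bound to [inf S]. *)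
apply: (cvgr_to_ge (@rcdf_right (inf S))); near=> y.
have [z Sz zy] : exists2 z, S z & z < y.
  by apply: inf_lt => //; near: y; exact: nbhs_right_gt.
by apply: le_trans Sz _; apply: rcdf_nondecreasing; exact: ltW.
Unshelve. all: by end_near. Qed.

Lemma measurable_quantile :
  measurable_fun setT (quantile : measurableTypeR R -> R).
Proof.
apply: (measurability _ (RGenOInfty.measurableE R)) => _ [_ [x ->] <-].
rewrite setTI.
rewrite (_ : _ @^-1` _ = (`]0, 1[ `&` `]rcdf m x, +oo[) `|`
  (~` `]0, 1[ `&` (if x < 0 then setT else set0))).
  apply: measurableU; apply: measurableI => //; first exact: measurableC.
  by case: ifP.
apply/seteqP; split=> u /=; rewrite !in_itv/= !andbT.
  case: (boolP (0 < u < 1)) => u01.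
    by rewrite ltNge quantile_le// -ltNge; left.
  by rewrite /quantile (negbTE u01) => ->; right; split=> //; exact/negP.
case=> [[u01]|[/negP u01]].
  by rewrite !ltNge quantile_le.
by rewrite /quantile (negbTE u01); case: ifP.
Qed.

HB.instance Definition _ := isMeasurableFun.Build _ _ _ _
  (quantile : measurableTypeR R -> R) measurable_quantile.

Definition quantileRV : {RV (uniform_prob (@ltr01 R)) >-> R} :=
  quantile : measurableTypeR R -> R.

(** With F the distribution function of [m], [quantile_le] places the event, within [0, 1], between
    ]0, F(x)[ and [0, F(x)] with the point 1 added. Both have Lebesgue measure F(x); the endpoints,
    where the quantile is a default value, are null. *)
Lemma cdf_quantile x : cdf quantileRV x = m `]-oo, x]%classic.
Proof.
rewrite -rcdfE /cdf /distribution /pushforward /=.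
set U := _ @^-1` _.
have mU : measurable (U : set (measurableTypeR R)).
  by rewrite -[U]setTI; exact: measurable_quantile.
have mU01 : measurable (U `&` `[0, 1] : set (measurableTypeR R)).
  exact: measurableI.
have -> : uniform_prob (@ltr01 R) U = lebesgue_measure (U `&` `[0, 1]).
  rewrite /uniform_prob integral_uniform_pdf -[RHS]mul1e -integral_cst//.
  apply: eq_integral => u; rewrite inE => -[_ /=]; rewrite in_itv/= => u01.
  by rewrite /uniform_pdf u01 subr0 invr1.
have F0 := rcdf_ge0 m x; have F1 := rcdf_le1 m x.
have UE u : 0 < u < 1 -> U u <-> u <= rcdf m x.
  by move=> u01; rewrite /U/= in_itv/= quantile_le.
apply/eqP; rewrite eq_le; apply/andP; split.
  pose V : set R := `[0, rcdf m x]%classic `|` [set 1].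
  have VF : (lebesgue_measure V <= (rcdf m x)%:E)%E.
    pose V0 : set R := `[0, rcdf m x]%classic.
    apply: (@le_trans _ _ (lebesgue_measure V0 + lebesgue_measure [set 1%R])%E).
      exact: measureU2.
    rewrite lebesgue_measure_set1 adde0 lebesgue_measure_itv/= lte_fin.
    by case: ifP => _; rewrite ?oppr0 ?adde0 ?lee_fin.
  apply: le_trans VF; apply: le_measure; rewrite ?inE//; first exact: measurableU.
  move=> u [Uu]; rewrite /= in_itv/= => /andP[u0 u1].
  have [->|u1'] := eqVneq u 1; [by right|left].
  rewrite /= in_itv/= u0/=; have [->//|u0'] := eqVneq u 0.
  by apply/UE => //; rewrite !lt_neqAle u0 u1 eq_sym u0' u1'.
have -> : (rcdf m x)%:E = lebesgue_measure (`]0, rcdf m x[%classic : set R).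
  by rewrite lebesgue_measure_itv/= lte_fin; case: ltgtP F0 => //= [_|<-] _;
    rewrite ?oppr0 ?adde0.
apply: le_measure; rewrite ?inE//.
move=> u; rewrite /= in_itv/= => /andP[u0 ux]; split.
  by apply/UE; [rewrite u0 (lt_le_trans ux)|exact: ltW].
by rewrite /= in_itv/= ltW//= (le_trans (ltW ux)).
Qed.

Lemma distribution_quantile A : measurable A ->
  distribution (uniform_prob (@ltr01 R)) quantileRV A = m A.
Proof. by apply: probability_eq_itv => x; exact: cdf_quantile. Qed.

End quantile.

(** * Convergence in mean square *)

Lemma integrable_sqrB d (T : measurableType d) (R : realType)
    (P : probability T R) (f g : T -> R) :
  measurable_fun setT f -> measurable_fun setT g ->
  P.-integrable setT (fun x => (f x ^+ 2)%:E) ->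
  P.-integrable setT (fun x => (g x ^+ 2)%:E) ->
  P.-integrable setT (fun x => ((f x - g x) ^+ 2)%:E).
Proof.
move=> mf mg if2 ig2.
apply: (@le_integrable _ _ _ P _ _ _
  (fun x => 2%:E * (f x ^+ 2)%:E + 2%:E * (g x ^+ 2)%:E)%E) => //.
- by apply/measurable_EFinP; apply: measurable_funX; exact: measurable_funB.
- move=> x _; rewrite -!EFinM -EFinD /= lee_fin !ger0_norm ?sqr_ge0//; last first.
    by have := sqr_ge0 (f x); have := sqr_ge0 (g x); lra.
  by have := sqr_ge0 (f x + g x); nra.
- by apply: integrableD => //; exact: integrableZl.
Qed.

(* By the parallelogram identity it suffices that the integrals of
   [(fn n + f)^2] tend to those of [4 f^2]; cutting at [4 f^2] only decreases
   them and makes dominated convergence applicable. *)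
Lemma cvg_sqr_dist d (T : measurableType d) (R : realType)
    (P : probability T R) (fn : nat -> {RV P >-> R}) (f : {RV P >-> R}) (C : R) :
  (forall n, (\int[P]_x (fn n x ^+ 2)%:E = C%:E)%E) ->
  (\int[P]_x (f x ^+ 2)%:E = C%:E)%E ->
  {ae P, forall x, fn n x @[n --> \oo] --> f x} ->
  \int[P]_x ((fn n x - f x) ^+ 2) @[n --> \oo] --> 0.
Proof.
move=> fnC fC fnf.
have ifn n := sqr_integrable (measurable_funP (fn n)) (fnC n).
have if2 := sqr_integrable (measurable_funP f) fC.
pose h n x := Num.min ((fn n x + f x) ^+ 2) (4 * f x ^+ 2).
have mh n : measurable_fun setT (h n).
  apply: measurable_minr; first by apply: measurable_funX; exact: measurable_funD.
  by apply: measurable_funM => //; exact: measurable_funX.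
have h0 n x : 0 <= h n x by rewrite le_min sqr_ge0 mulr_ge0 ?sqr_ge0.
have i4 : P.-integrable setT (EFin \o (fun x => 4 * f x ^+ 2)).
  by rewrite /comp; under eq_fun do rewrite EFinM; exact: integrableZl.
have ih n : P.-integrable setT (EFin \o h n).
  apply: (le_integrable _ _ _ i4) => //; first exact/measurable_EFinP.
  move=> x _; rewrite /= lee_fin !ger0_norm ?h0//; last first.
    by rewrite mulr_ge0 ?sqr_ge0.
  by rewrite ge_min lexx orbT.
have i2n n : P.-integrable setT (EFin \o (fun x => 2 * fn n x ^+ 2)).
  by rewrite /comp; under eq_fun do rewrite EFinM; exact: integrableZl.
have i2 : P.-integrable setT (EFin \o (fun x => 2 * f x ^+ 2)).
  by rewrite /comp; under eq_fun do rewrite EFinM; exact: integrableZl.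
have isum n : P.-integrable setT (EFin \o (fun x => 2 * fn n x ^+ 2 + 2 * f x ^+ 2)).
  exact: (@integrableD _ _ _ P setT measurableT _ _ (i2n n) i2).
have ib n : P.-integrable setT
    (EFin \o (fun x => 2 * fn n x ^+ 2 + 2 * f x ^+ 2 - h n x)).
  exact: (@integrableB _ _ _ P setT measurableT _ _ (isum n) (ih n)).
have idist n : P.-integrable setT (EFin \o (fun x => (fn n x - f x) ^+ 2)).
  exact: integrable_sqrB.
have dist_le n : \int[P]_x ((fn n x - f x) ^+ 2) <= 4 * C - \int[P]_x h n x.
  have -> : 4 * C = \int[P]_x (2 * fn n x ^+ 2 + 2 * f x ^+ 2).
    rewrite RintegralD//= (RintegralZl _ measurableT (ifn n)).
    rewrite (RintegralZl _ measurableT if2) /Rintegral.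
    by rewrite (fnC n) fC /=; ring.
  rewrite -RintegralB//; apply: le_Rintegral => // x _.
  rewrite lerBrDl addrC -lerBrDl /h ge_min.
  by apply/orP; left; rewrite le_eqVlt; apply/orP; left; apply/eqP; ring.
apply: (@squeeze_cvgr _ _ _ _ (cst 0) (fun n => 4 * C - \int[P]_x h n x)).
- by apply: nearW => n; rewrite dist_le andbT;
  apply: Rintegral_ge0 => x _; rewrite sqr_ge0.
- exact: cvg_cst.
have [] := @dominated_convergence _ _ R P setT measurableT
  (fun n x => (h n x)%:E) (fun x => (4 * f x ^+ 2)%:E) (fun x => (4 * f x ^+ 2)%:E).
- by move=> n; exact/measurable_EFinP.
- by case/integrableP: i4.
- apply: filterS fnf => x fx _; apply/fine_cvgP; split; first exact: nearW.
  rewrite /comp/= /h; set L := 4 * f x ^+ 2.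
  apply: (@squeeze_cvgr _ _ _ _ (fun n => L - `|L - (fn n x + f x) ^+ 2|) (cst L)).
  (* The lower bound is min(z, L) >= L - |L - z|, with z = (fn + f)^2 tending to L = (2 f)^2. *)
  + apply: nearW => n; rewrite ge_min lexx orbT andbT le_min; apply/andP; split.
      by rewrite lerBlDr -lerBlDl ler_norm.
    by rewrite gerBl.
  + rewrite -[X in _ --> X]subr0; apply: cvgB; first exact: cvg_cst.
    rewrite -(normr0 R) -(subrr L); apply: cvg_norm; apply: cvgB.
      exact: cvg_cst.
    rewrite /L (_ : 4 * f x ^+ 2 = (f x + f x) ^+ 2); last by ring.
    by apply: cvgM; (apply: cvgD; [exact: fx|exact: cvg_cst]).
  + exact: cvg_cst.
- exact: i4.
- apply: aeW => x n _; rewrite /= lee_fin ger0_norm// /h ge_min lexx orbT//.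
have -> : (\int[P]_x (4 * f x ^+ 2)%:E = (4 * C)%:E)%E.
  by under eq_integral do rewrite EFinM; rewrite integralZl// fC.
move=> _ _ /fine_cvgP[_ hC].
rewrite -(subrr (4 * C)); apply: cvgB; first exact: cvg_cst.
exact: hC.
Qed.

Lemma integral_prob_cst d (T : measurableType d) (R : realType)
  (P : probability T R) (r : R) : (\int[P]_x r%:E = r%:E)%E.
Proof. by have := expectation_cst P r; rewrite expectation.unlock. Qed.

Lemma integral_sqr_translate d (T : measurableType d) (R : realType)
    (P : probability T R) (f : T -> R) (C y : R) : measurable_fun setT f ->
  (\int[P]_x (f x)%:E = 0)%E -> (\int[P]_x (f x ^+ 2)%:E = C%:E)%E ->
  (\int[P]_x ((f x + y) ^+ 2)%:E = (C + y ^+ 2)%:E)%E.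
Proof.
move=> mf f0 fC.
have if2 := sqr_integrable mf fC; have if1 := sqr_integrable_integrable mf fC.
have i1 : P.-integrable setT (EFin \o (fun x => 2 * y * f x)).
  by rewrite /comp; under eq_fun do rewrite EFinM; exact: (integrableZl measurableT _ if1).
have i2 : P.-integrable setT (EFin \o (fun x => f x ^+ 2 + 2 * y * f x)).
  exact: (@integrableD _ _ _ P setT measurableT _ _ if2 i1).
have i3 : P.-integrable setT (EFin \o cst (y ^+ 2)).
  exact: (finite_measure_integrable_cst P).
transitivity (\int[P]_x ((f x ^+ 2 + 2 * y * f x)%:E + (y ^+ 2)%:E))%E.
  by apply: eq_integral => x _; rewrite -EFinD; congr EFin; ring.
rewrite (integralD measurableT i2 i3) [X in (_ + X)%E]integral_prob_cst.
rewrite EFinD; congr (_ + _)%E.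
transitivity (\int[P]_x ((f x ^+ 2)%:E + (2 * y * f x)%:E))%E.
  by apply: eq_integral => x _; rewrite /= EFinD.
rewrite (integralD measurableT if2 i1) fC.
under [X in (_ + X)%E]eq_integral do rewrite /= EFinM.
by rewrite integralZl// f0 mule0 adde0.
Qed.

(** * Second moments of partial and normalized sums *)

Section second_moments.
Context {R : realType} d (T : measurableType d) (P : probability T R).
Variables (X : nat -> {RV P >-> R}) (s : R).
Hypothesis indX : mutually_independent X.
Hypothesis EX : forall i, ('E_P[X i] = 0)%E.
Hypothesis VX : forall i, ('V_P[X i] = (s ^+ 2)%:E)%E.

Let X_mean i : (\int[P]_w (X i w)%:E = 0)%E.
Proof. by have := EX i; rewrite expectation.unlock. Qed.

Let X_sqr i : (\int[P]_w (X i w ^+ 2)%:E = (s ^+ 2)%:E)%E.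
Proof.
have := VX i; rewrite /variance covariance.unlock EX/= expectation.unlock => <-.
by apply: eq_integral => w _; rewrite !fctE /= subr0.
Qed.

Let X_integrable i : P.-integrable setT (EFin \o X i).
Proof. by apply: (sqr_integrable_integrable _ (X_sqr i)). Qed.

Lemma centered_distribution i : centered (distribution P (X i)) s.
Proof.
split; last first.
  rewrite ge0_integral_distribution//.
  - exact: X_sqr.
  - exact/measurable_EFinP/measurable_funX.
  - by move=> x; rewrite lee_fin sqr_ge0.
rewrite (integral_distribution (X := X i) (f := EFin))//; exact: X_mean.
Qed.

Lemma partial_sum_mean k : P.-integrable setT (EFin \o partial_sum X k) /\
  (\int[P]_w (partial_sum X k w)%:E = 0)%E.
Proof.
elim: k => [|k [IHi IH]].
  rewrite (_ : partial_sum X 0 = cst 0); last first.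
    by apply/funext => w; rewrite /partial_sum big_ord0.
  by split; [exact: (finite_measure_integrable_cst P)|rewrite integral0].
have -> : EFin \o partial_sum X k.+1 =
    (EFin \o partial_sum X k) \+ (EFin \o X k).
  by apply/funext => w; rewrite /= /partial_sum big_ord_recr.
split; first exact: (@integrableD _ _ _ P setT measurableT).
rewrite -[LHS]/(\int[P]_w ((EFin \o partial_sum X k.+1) w))%E.
rewrite (_ : EFin \o partial_sum X k.+1 =
    (fun w => (EFin \o partial_sum X k) w + (EFin \o X k) w)%E); last first.
  by apply/funext => w; rewrite /= /partial_sum big_ord_recr.
by rewrite integralD// IH X_mean adde0.
Qed.

(** Induction: for a fixed value y of the new summand, the centred sum translated by y has second
    moment k s^2 + y^2. Independence enters through [partial_sumS_integral]. *)
Lemma partial_sum_sqr k :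
  (\int[P]_w (partial_sum X k w ^+ 2)%:E = (s ^+ 2 *+ k)%:E)%E.
Proof.
elim: k => [|k IH].
  rewrite mulr0n; apply: integral0_eq => w _.
  by rewrite /partial_sum big_ord0 expr0n.
have msq : measurable_fun setT (fun x : R => (x ^+ 2)%:E).
  exact/measurable_EFinP/measurable_funX.
have sq0 (x : R) : (0 <= (x ^+ 2)%:E)%E by rewrite lee_fin sqr_ge0.
transitivity (\int[distribution P (partial_sum X k.+1 : {RV P >-> R})]_x (x ^+ 2)%:E)%E.
  by rewrite [RHS](ge0_integral_distribution _ msq sq0).
rewrite (partial_sumS_integral indX k msq sq0).
transitivity (\int[distribution P (X k)]_y (s ^+ 2 *+ k + y ^+ 2)%:E)%E.
  apply: eq_integral => y _.
  have msqy : measurable_fun setT (fun x : R => ((x + y) ^+ 2)%:E).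
    by apply/measurable_EFinP; apply: measurable_funX; exact: measurable_funD.
  have sqy0 (x : R) : (0 <= ((x + y) ^+ 2)%:E)%E by rewrite lee_fin sqr_ge0.
  rewrite [LHS](ge0_integral_distribution _ msqy sqy0).
  apply: (integral_sqr_translate y _ _ IH); first exact: measurable_partial_sum.
  by have [] := partial_sum_mean k.
under eq_integral do rewrite EFinD.
rewrite ge0_integralD//=; last by move=> x _; rewrite lee_fin mulrn_wge0// sqr_ge0.
have [_ ->] := centered_distribution k.
by rewrite integral_prob_cst mulrSr EFinD.
Qed.

Lemma normalized_sum_sqr k :
  (\int[P]_w (normalized_sumRV X k.+1 w ^+ 2)%:E = (s ^+ 2)%:E)%E.
Proof.
transitivity (\int[P]_w ((k.+1%:R^-1)%:E * (partial_sum X k.+1 w ^+ 2)%:E))%E.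
  apply: eq_integral => w _; rewrite -EFinM; congr EFin.
  by rewrite /= /normalized_sum expr_div_n sqr_sqrtr ?ler0n// mulrC.
rewrite ge0_integralZl//.
- rewrite partial_sum_sqr -EFinM -[s ^+ 2 *+ _]mulr_natr mulrCA.
  by rewrite mulVf ?mulr1// pnatr_eq0.
- apply/measurable_EFinP; apply: measurable_funX; exact: measurable_partial_sum.
- by move=> w _; rewrite lee_fin sqr_ge0.
Qed.

End second_moments.

(** * Pointwise convergence of quantile functions *)

(** On ]x, y] the density is at least its value at [M], the larger of |x| and |y|, so this interval
    has positive mass. *)
Lemma rcdf_normal_law_lt (R : realType) (s x y : R) : s != 0 -> x < y ->
  rcdf (normal_law s) x < rcdf (normal_law s) y.
Proof.
move=> s0 xy; rewrite -lte_fin !rcdfE.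
have -> : (`]-oo, y]%classic : set R) = `]-oo, x] `|` `]x, y].
  by rewrite -itv_bndbnd_setU// bnd_simp ltW.
rewrite measureU//; last first.
  apply/seteqP; split=> // z /= []; rewrite !in_itv/= => zx /andP[xz _].
  by move: xz; rewrite ltNge zx.
rewrite lteDl//; last exact: fin_num_measure.
pose M := Num.max `|x| `|y|.
have pM : 0 < normal_pdf 0 s M.
  by rewrite normal_pdfE// mulr_gt0 ?normal_peak_gt0 ?expR_gt0.
have xM : `|x| <= M by rewrite le_max lexx.
have yM : `|y| <= M by rewrite le_max lexx orbT.
apply: (@lt_le_trans _ _
  (\int[lebesgue_measure]_(z in `]x, y]) (normal_pdf 0 s M)%:E)%E).
  rewrite integral_cst//= lebesgue_measure_itv/= lte_fin xy.
  by rewrite -EFinD -EFinM lte_fin mulr_gt0// subr_gt0.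
rewrite [leRHS]normal_lawE /normal_prob; apply: ge0_le_integral => //.
- by move=> z _; rewrite lee_fin ltW.
- by apply/measurable_EFinP/measurable_funTS; exact: measurable_normal_pdf.
move=> z; rewrite /= in_itv/= => /andP[xz zy]; rewrite lee_fin.
rewrite !normal_pdfE//= ler_pM2l ?normal_peak_gt0// /normal_fun ler_expR.
rewrite !subr0 !mulNr lerN2 ler_pM2r ?invr_gt0 ?pmulrn_lgt0 ?exprn_even_gt0//.
rewrite -(real_normK (num_real z)) lerXn2r ?nnegrE//.
  by rewrite le_max; apply/orP; left; rewrite normr_ge0.
rewrite ler_norml; move: xM yM; rewrite !ler_norml => /andP[Mx _] /andP[_ yM].
by rewrite (le_trans Mx (ltW xz)) (le_trans zy yM).
Qed.

(** By [quantile_le] it is enough that u eventually separates the values of [rcdf (mu n)] at q - e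
    and q + e. The limit does so at q - e / 2 by definition of q, and at q + e / 2 by strict
    monotonicity; the remaining e / 2 is the room that [rcdf_lt_near] and [rcdf_gt_near] ask for. *)
Lemma quantile_cvg (R : realType) (mu : nat -> probability R R)
    (m : probability R R) (u : R) :
  (forall a b, \int[mu n]_t logistic (b + a * t) @[n --> \oo] -->
     \int[m]_t logistic (b + a * t)) ->
  {homo rcdf m : x y / x < y} -> 0 < u < 1 ->
  quantile (mu n) u @[n --> \oo] --> quantile m u.
Proof.
move=> mum Fm u01; set q := quantile m u.
apply/cvgrPdist_le => e e0.
have near1 : \forall n \near \oo, rcdf (mu n) (q - e) < u.
  apply: (rcdf_lt_near mum (y := q - e / 2)).
    by rewrite ltrD2l ltrN2; lra.
  by rewrite ltNge -quantile_le// -ltNge /q ltrBlDr ltrDl divr_gt0.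
have near2 : \forall n \near \oo, u < rcdf (mu n) (q + e).
  apply: (rcdf_gt_near mum (x := q + e / 2)).
    by rewrite ltrD2l; lra.
  apply: (@le_lt_trans _ _ (rcdf m q)); first by rewrite -quantile_le.
  by apply: Fm; rewrite ltrDl divr_gt0.
near=> n.
have h1 : rcdf (mu n) (q - e) < u by near: n.
have h2 : u < rcdf (mu n) (q + e) by near: n.
have {}h1 : q - e < quantile (mu n) u by rewrite ltNge quantile_le// -ltNge.
have {}h2 : quantile (mu n) u <= q + e by rewrite quantile_le// ltW.
by rewrite ler_distl; lra.
Unshelve. all: by end_near. Qed.

(** The uniform law is carried by [0, 1], and its two endpoints are Lebesgue-null. *)
Lemma ae_uniform_prob (R : realType) (Q : R -> Prop) :
  (forall u, 0 < u < 1 -> Q u) -> {ae (uniform_prob (@ltr01 R)), forall u, Q u}.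
Proof.
move=> Q01; exists (~` `]0, 1[%classic); split.
- exact: measurableC.
- rewrite /uniform_prob integral_uniform_pdf; apply: null_set_integral => //.
  + by apply: measurableI => //; exact: measurableC.
  + by apply/measurable_EFinP/measurable_funTS; exact: measurable_uniform_pdf.
  + apply: countable_lebesgue_measure0; apply: finite_set_countable.
    apply: (@sub_finite_set _ _ [set 0; 1]) => // u [] /=.
    rewrite !in_itv/= => /negP u01 /andP[u0 u1].
    have [->|u0'] := eqVneq u 0; [by left|right].
    apply/eqP; move: u01; rewrite !lt_neqAle u0 u1 eq_sym u0'/= andbT.
    by rewrite negbK.
move=> u /= nQ u01; apply: nQ; apply: Q01.
by move: u01; rewrite in_itv.
Qed.

Theorem theorem1p2 (R : realType)
    (d : measure_display) (T : measurableType d) (P : probability T R)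
    (X : nat -> {RV P >-> R})
    (d' : measure_display) (T' : measurableType d') (P' : probability T' R)
    (Z : {RV P' >-> R}) (sigma : R) :
  mutually_independent X ->
  identically_distributed X ->
  (forall i : nat, 'E_P[X i] = 0)%E ->
  0 < sigma ->
  (forall i : nat, 'V_P[X i] = (sigma ^+ 2)%:E)%E ->
  normal_RV 0 sigma Z ->
  mallowsRV 2 (normalized_sumRV X n) Z @[n --> \oo] --> 0%E.
Proof.
move=> indX idX EX sigma0 VX ZN.
have s0 := lt0r_neq0 sigma0.
pose U := uniform_prob (@ltr01 R).
pose mu n : probability R R := distribution P (normalized_sumRV X n).
pose Qn n := quantileRV (mu n); pose Q := quantileRV (normal_law sigma).
have clt := normalized_sum_logistic_clt indX idX (centered_distribution EX VX 0)
  sigma0.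
have sqr_quantile (m : probability R R) :
    (\int[m]_x (x ^+ 2)%:E = (sigma ^+ 2)%:E)%E ->
    (\int[U]_u (quantileRV m u ^+ 2)%:E = (sigma ^+ 2)%:E)%E.
  move=> <-.
  have msq : measurable_fun setT (fun x : R => (x ^+ 2)%:E).
    exact/measurable_EFinP/measurable_funX.
  have sq0 (x : R) : (0 <= (x ^+ 2)%:E)%E by rewrite lee_fin sqr_ge0.
  (* The quantile function has law [m], so it inherits the second moment of [m]. *)
  rewrite -[LHS](ge0_integral_distribution (quantileRV m) msq sq0).
  by apply: eq_measure_integral => A mA _; exact: distribution_quantile.
have Qn_sqr n : (\int[U]_u (Qn n.+1 u ^+ 2)%:E = (sigma ^+ 2)%:E)%E.
  apply: sqr_quantile.
  rewrite ge0_integral_distribution//; first exact: normalized_sum_sqr.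
  - exact/measurable_EFinP/measurable_funX.
  - by move=> x; rewrite lee_fin sqr_ge0.
have Q_sqr : (\int[U]_u (Q u ^+ 2)%:E = (sigma ^+ 2)%:E)%E.
  by apply: sqr_quantile; have [] := centered_normal_law s0.
have QnQ : {ae U, forall u, Qn n.+1 u @[n --> \oo] --> Q u}.
  apply: ae_uniform_prob => u u01; rewrite (cvg_shiftS (fun n => Qn n u)).
  apply: quantile_cvg => //.
  by move=> x y; exact: rcdf_normal_law_lt.
have L2 := cvg_sqr_dist Qn_sqr Q_sqr QnQ.
have mallows_le n : (mallowsRV 2 (normalized_sumRV X n.+1) Z <=
    (Num.sqrt (\int[U]_u ((Qn n.+1 u - Q u) ^+ 2)))%:E)%E.
  set D := fun u => Qn n.+1 u - Q u.
  have iD : U.-integrable setT (EFin \o (fun u => D u ^+ 2)).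
    apply: integrable_sqrB => //.
      exact: sqr_integrable (Qn_sqr n).
    exact: sqr_integrable Q_sqr.
  have DE : (\int[U]_u (D u ^+ 2)%:E = (\int[U]_u (D u ^+ 2))%:E)%E.
    by rewrite fineK//; exact: integrable_fin_num.
  have D0 : 0 <= \int[U]_u (D u ^+ 2).
    by apply: Rintegral_ge0 => u _; exact: sqr_ge0.
  have -> : ((Num.sqrt (\int[U]_u (D u ^+ 2)))%:E =
      (\int[U]_u (D u ^+ 2))%:E `^ 2^-1)%E by rewrite poweR12_sqrt ?lee_fin.
  (* The power 1/2 is monotone only on nonnegative extended reals, so the infimum has to be located
     there first. *)
  have costs_ge0 : (0 <= ereal_inf (coupling_costs 2
      (cdf (normalized_sumRV X n.+1)) (cdf Z)))%E.
    apply: le_ereal_inf_tmp => _ [? [? [? [? [? [_ _ ->]]]]]].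
    by apply: expectation_ge0 => w; exact: powR_ge0.
  apply: gt0_ler_poweR; rewrite ?invr_ge0 ?in_itv/= ?leey ?andbT ?lee_fin//.
  apply: ereal_inf_lbound.
  (* The quantile coupling is one admissible pair, so its cost bounds the infimum; [Z] enters only
     through its distribution function. *)
  exists _, _, U, (Qn n.+1), Q; split.
  - by apply/funext => x; rewrite cdf_quantile.
  - by apply/funext => x; rewrite cdf_quantile normal_lawE -ZN.
  - rewrite expectation.unlock -DE; apply: eq_integral => u _.
    by rewrite /= powR_mulrn// real_normK ?num_real.
(* The index is shifted because the normalized sum at n = 0 is 0. *)
rewrite -cvg_shiftS.
have sqrtL2 : (Num.sqrt (\int[U]_u ((Qn n.+1 u - Q u) ^+ 2)))%:E
    @[n --> \oo] --> 0%E.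
  apply/fine_cvgP; split; first exact: nearW.
  rewrite -[X in _ --> X]sqrtr0; apply: continuous_cvg; first exact: sqrt_continuous.
  exact: L2.
apply: (squeeze_cvge _ (cvg_cst 0%E) sqrtL2).
by apply: nearW => n; rewrite mallows_le andbT poweR_ge0.
Qed.
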